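(* For every integer $r\ge 1$, $\mathrm{TC}^S(\mathrm{P}^r)=\mathrm{level}\left(\mathrm{P}^r\times\mathrm{P}^r-\Delta_{\mathrm{P}^r},\mathbb{Z}/2\right)+1$, where $\mathbb{Z}/2$ acts on $\mathrm{P}^r\times\mathrm{P}^r-\Delta_{\mathrm{P}^r}$ by interchanging coordinates.
   Context: $\mathrm{P}^r$ denotes the $r$-dimensional real projective space, and $\Delta_X\subset X\times X$ the diagonal of a space $X$. The Schwarz genus $\mathrm{genus}(p)$ of a fibration $p\colon E\to B$ is the smallest number of open sets $U$ covering $B$ such that $p$ admits a continuous section over each $U$. For a topological space $X$, let $P(X)=X^{[0,1]}$ be the free path space with the compact-open topology, and $\mathrm{ev}\colon P(X)\to X\times X$, $\gamma\mapsto(\gamma(0),\gamma(1))$. Let $\mathrm{ev}_1\colon P_1(X)\to X\times X-\Delta_X$ be the restriction of $\mathrm{ev}$, so $P_1(X)$ is the subspace of paths $\gamma$ with $\gamma(0)\neq\gamma(1)$. The group $\mathbb{Z}/2$ acts freely on $P_1(X)$ by running paths backwards and on $X\times X-\Delta_X$ by switching coordinates, and $\mathrm{ev}_1$ is equivariant. Let $P_2(X)$ and $B(X,2)$ be the orbit spaces and $\mathrm{ev}_2\colon P_2(X)\to B(X,2)$ the induced fibration. The symmetric topological complexity of $X$ is $\mathrm{TC}^S(X)=\mathrm{genus}(\mathrm{ev}_2)+1$. For a principal $\mathbb{Z}/2$-action on a space $X$, $\mathrm{level}(X,\mathbb{Z}/2)$ is the smallest integer $\ell>0$ for which there exists a continuous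 $\mathbb{Z}/2$-equivariant map $X\to S^{\ell-1}$, where the sphere carries the antipodal action. *)

(* Defs.v *)
From HB Require Import structures.
From mathcomp Require Import all_boot all_order all_algebra generic_quotient.
From mathcomp Require Import all_classical reals topology normedtype.

Set Implicit Arguments.
Unset Strict Implicit.
Unset Printing Implicit Defensive.

Import Order.TTheory GRing.Theory Num.Theory.
Import numFieldNormedType.Exports.

Local Open Scope classical_set_scope.
Local Open Scope ring_scope.
Local Open Scope quotient_scope.

Lemma set_type_continuous (T U : topologicalType) (A : set U) (f : T -> A) :
  continuous (set_val \o f) -> continuous f.
Proof. by move=> cf; apply: continuous_comp_initial. Qed.

Lemma set_val_continuous (T : topologicalType) (A : set T) :
  continuous (set_val : A -> T).
Proof. exact: initial_continuous. Qed.

(* A free continuous action of Z/2, given by its generator. On a Hausdorff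
   space such an action is principal. *)
Record free_involution (T : topologicalType) := FreeInvolution {
  inv_fun :> T -> T;
  inv_continuous : continuous inv_fun;
  inv_involutive : involutive inv_fun;
  inv_free : forall x, inv_fun x <> x
}.

Section orbit_space.
Variables (T : topologicalType) (tau : free_involution T).

Definition same_orbit (x y : T) : bool := (x == y) || (x == tau y).

Lemma same_orbit_refl : reflexive same_orbit.
Proof. by move=> x; rewrite /same_orbit eqxx. Qed.

Lemma same_orbit_sym : symmetric same_orbit.
Proof.
move=> x y; rewrite /same_orbit eq_sym; congr orb.
by apply/eqP/eqP => ->; rewrite inv_involutive.
Qed.

Lemma same_orbit_trans : transitive same_orbit.
Proof.
move=> y x z /orP[/eqP ->//|/eqP ->] /orP[/eqP ->|/eqP ->].
  by rewrite /same_orbit eqxx orbT.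
by rewrite /same_orbit inv_involutive eqxx.
Qed.

Definition orbit_rel :=
  EquivRel same_orbit same_orbit_refl same_orbit_sym same_orbit_trans.

Definition orbit_space : Type := quotient_topology {eq_quot orbit_rel}.

HB.instance Definition _ := Quotient.on orbit_space.
HB.instance Definition _ :=
  Topological.copy orbit_space (quotient_topology {eq_quot orbit_rel}).

Definition orbit_proj : T -> orbit_space := \pi_orbit_space.

Lemma orbit_projP (x y : T) :
  orbit_proj x = orbit_proj y <-> x = y \/ x = tau y.
Proof.
split=> [/eqmodP /= /orP[]/eqP|[]e]; [by left|by right|by rewrite e|].
by apply/eqmodP => /=; apply/orP; right; apply/eqP.
Qed.

End orbit_space.

Section orbit_map.
Variables (T U : topologicalType).
Variables (tau : free_involution T) (sigma : free_involution U).

(* The map induced on orbit spaces by an equivariant map. *)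
Definition orbit_map (f : T -> U) (x : orbit_space tau) : orbit_space sigma :=
  orbit_proj sigma (f (repr x)).

Lemma orbit_mapE (f : T -> U) : {morph f : x / tau x >-> sigma x} ->
  forall x, @orbit_map f (orbit_proj tau x) = orbit_proj sigma (f x).
Proof.
move=> fM x; rewrite /orbit_map.
have /orbit_projP[->//|->] :
    orbit_proj tau (repr (orbit_proj tau x)) = orbit_proj tau x by exact: reprK.
by rewrite fM; apply/orbit_projP; right.
Qed.

End orbit_map.

Arguments orbit_map {T U} tau sigma f x.

(* Not every set of naturals has a smallest element, so invariants defined as
   minima are rendered as predicates on their (unique) value. *)
Definition smallest (P : set nat) (n : nat) :=
  P n /\ forall m, P m -> (n <= m)%N.

Lemma smallest_unique (P : set nat) (m n : nat) :
  smallest P m -> smallest P n -> m = n.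
Proof.
by move=> [Pm lem] [Pn len]; apply/eqP; rewrite eqn_leq lem// len.
Qed.

Definition has_section_over (E B : topologicalType) (p : E -> B) (U : set B) :=
  exists s : U -> E, continuous s /\ forall b : U, p (s b) = set_val b.

Definition is_genus (E B : topologicalType) (p : E -> B) : nat -> Prop :=
  smallest [set n | exists U : 'I_n -> set B,
    [/\ forall i, open (U i),
        \bigcup_i U i = [set: B]
      & forall i, has_section_over p (U i)]].

Section sphere.
Variables (R : realType) (n : nat).

(* The n-sphere, in R^(n+1). *)
Definition sphere : topologicalType :=
  set_type [set x : 'rV[R]_n.+1 | \sum_i x ord0 i ^+ 2 = 1].

Lemma antipode_subproof (x : sphere) :
  - set_val x \in [set x : 'rV[R]_n.+1 | \sum_i x ord0 i ^+ 2 = 1].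
Proof.
case: x => x xP; have xS := set_mem xP; apply/mem_set; rewrite /= -[RHS]xS.
by apply: eq_bigr => i _; rewrite set_valE /= mxE sqrrN.
Qed.

Definition antipode_fun (x : sphere) : sphere := SigSub (antipode_subproof x).

Lemma antipode_continuous : continuous antipode_fun.
Proof.
apply: set_type_continuous => x; apply: continuousN.
exact: set_val_continuous.
Qed.

Lemma antipodeK : involutive antipode_fun.
Proof. by move=> x; apply/val_inj => /=; rewrite set_valE opprK. Qed.

Lemma antipode_free x : antipode_fun x <> x.
Proof.
move=> /(congr1 set_val); rewrite set_valE /= set_valE => xN.
have x0 : val x = 0.
  apply/rowP => i; have /rowP/(_ i) := xN; rewrite !mxE => /eqP.
  by rewrite eq_sym -subr_eq0 opprK -mulr2n mulrn_eq0 /= => /eqP.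
case: x {xN} x0 => x xP /= x0; have /= := set_mem xP; rewrite x0 big1.
  by move/esym/eqP; rewrite oner_eq0.
by move=> i _; rewrite mxE expr0n.
Qed.

Definition antipode : free_involution sphere :=
  FreeInvolution antipode_continuous antipodeK antipode_free.

End sphere.

Definition projective_space (R : realType) (r : nat) : topologicalType :=
  orbit_space (antipode R r).

(* The level of T, via equivariant maps to spheres over the reals R. *)
Definition is_level (R : realType) (T : topologicalType)
    (tau : free_involution T) : nat -> Prop :=
  smallest [set l | (0 < l)%N /\ exists f : T -> sphere R l.-1,
    continuous f /\ forall x, f (tau x) = antipode R l.-1 (f x)].

Section configuration.
Variable X : topologicalType.

Definition conf2 : topologicalType :=
  set_type (~` [set xy : X * X | xy.1 = xy.2]).

Lemma swap_subproof (x : conf2) :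
  ((set_val x).2, (set_val x).1) \in ~` [set xy : X * X | xy.1 = xy.2].
Proof.
case: x => -[x y] xyP; have xy := set_mem xyP; apply/mem_set => /= yx.
by apply: xy; rewrite /= yx.
Qed.

Definition swap_fun (x : conf2) : conf2 := SigSub (swap_subproof x).

Lemma swap_fun_continuous : continuous swap_fun.
Proof.
apply: set_type_continuous.
suff : continuous ((fun xy => (xy.2, xy.1)) \o (set_val : conf2 -> X * X)) by [].
move=> x; apply: continuous_comp; first exact: set_val_continuous.
exact: swap_continuous.
Qed.

Lemma swapK : involutive swap_fun.
Proof. by move=> -[[x y] xy]; apply/val_inj. Qed.

Lemma swap_free x : swap_fun x <> x.
Proof.
case: x => -[x y] xy /(congr1 val) /= [yx _].
by have := set_mem xy; apply.
Qed.

Definition conf2_swap : free_involution conf2 :=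
  FreeInvolution swap_fun_continuous swapK swap_free.

End configuration.

Section paths.
Variables (R : realType) (X : topologicalType).

Definition unit_interval : topologicalType := set_type `[0 : R, 1 : R]%classic.

Lemma in_unit0 : 0 \in `[0 : R, 1 : R]%classic.
Proof. by apply/mem_set; rewrite /= in_itv /= lexx ler01. Qed.
Lemma in_unit1 : 1 \in `[0 : R, 1 : R]%classic.
Proof. by apply/mem_set; rewrite /= in_itv /= lexx ler01. Qed.
Lemma in_unit_onem (t : unit_interval) : 1 - set_val t \in `[0 : R, 1 : R]%classic.
Proof.
case: t => t tP; have /= := set_mem tP; rewrite in_itv /= => /andP[t0 t1].
by apply/mem_set; rewrite /= in_itv /= subr_ge0 t1 gerBl t0.
Qed.

Definition unit0 : unit_interval := SigSub in_unit0.
Definition unit1 : unit_interval := SigSub in_unit1.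
Definition unit_onem (t : unit_interval) : unit_interval :=
  SigSub (in_unit_onem t).

Lemma unit_onem_continuous : continuous unit_onem.
Proof.
apply: set_type_continuous.
suff : continuous ((fun t : R => 1 - t) \o (set_val : unit_interval -> R)) by [].
move=> t; apply: continuous_comp; first exact: set_val_continuous.
by apply: continuousB; [exact: cst_continuous|exact: cvg_id].
Qed.

HB.instance Definition _ :=
  isContinuous.Build unit_interval unit_interval unit_onem unit_onem_continuous.

Definition path_space : Type := continuousType unit_interval X.

Definition path_val (g : path_space) : {compact-open, unit_interval -> X} :=
  (g : unit_interval -> X).

HB.instance Definition _ := Choice.on path_space.
HB.instance Definition _ :=
  Topological.copy path_space (initial_topology path_val).

Definition ev (g : path_space) : X * X := (g unit0, g unit1).

Definition path_space1 : topologicalType :=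
  set_type [set g : path_space | g unit0 <> g unit1].

Lemma ev1_subproof (g : path_space1) :
  ev (set_val g) \in ~` [set xy : X * X | xy.1 = xy.2].
Proof. by case: g => g gP; have g01 := set_mem gP; exact/mem_set. Qed.

Definition ev1 (g : path_space1) : conf2 X := SigSub (ev1_subproof g).

Definition reverse (g : path_space) : path_space := g \o unit_onem.

Lemma unit_onem0 : unit_onem unit0 = unit1.
Proof. by apply/val_inj; rewrite /= set_valE /= subr0. Qed.
Lemma unit_onem1 : unit_onem unit1 = unit0.
Proof. by apply/val_inj; rewrite /= set_valE /= subrr. Qed.

Lemma path_reversal_subproof (g : path_space1) :
  reverse (set_val g) \in [set g : path_space | g unit0 <> g unit1].
Proof.
case: g => g gP; have /= g01 := set_mem gP; apply/mem_set => /=.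
by rewrite unit_onem0 unit_onem1 => /esym.
Qed.

Definition path_reversal_fun (g : path_space1) : path_space1 :=
  SigSub (path_reversal_subproof g).

Lemma reverse_continuous : continuous reverse.
Proof.
apply: (@continuous_comp_initial path_space _ _ path_val) => g.
have FF : Filter (nbhs g) by exact: nbhs_filter.
have F1 : Filter (path_val @ g) by exact: fmap_filter.
have F2 : Filter ((path_val \o reverse) @ g) by exact: fmap_filter.
have /(compact_open_cvgP _ F1) gP : path_val @ g --> path_val g.
  exact: (@initial_continuous path_space _ path_val g).
apply/(compact_open_cvgP _ F2) => K O cK oO gKO.
have cK' : compact (unit_onem @` K).
  apply: continuous_compact => //; apply: continuous_subspaceT.
  exact: unit_onem_continuous.
have gKO' : path_val g @` (unit_onem @` K) `<=` O.
  by move=> _ [_ [t Kt <-] <-]; apply: gKO; exists t.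
apply: (@filterS _ (nbhs g) FF _ _ _ (gP _ _ cK' oO gKO')) => h hKO.
by move=> _ [t Kt <-]; apply: hKO; exists (unit_onem t) => //; exists t.
Qed.

Lemma path_reversal_continuous : continuous path_reversal_fun.
Proof.
apply: set_type_continuous.
suff : continuous (reverse \o (set_val : path_space1 -> path_space)) by [].
move=> g; apply: continuous_comp; first exact: set_val_continuous.
exact: reverse_continuous.
Qed.

Lemma path_reversalK : involutive path_reversal_fun.
Proof.
move=> g; apply/val_inj/continuousEP => t /=; congr (_ _).
by apply/val_inj; rewrite /= !set_valE /= opprB addrC subrK.
Qed.

Lemma path_reversal_free g : path_reversal_fun g <> g.
Proof.
case: g => g gP; have /= g01 := set_mem gP; move=> /(congr1 val) /= /continuousEP gN.
by apply: g01; rewrite -gN /= set_valE /= unit_onem0.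
Qed.

Definition path_reversal : free_involution path_space1 :=
  FreeInvolution path_reversal_continuous path_reversalK path_reversal_free.

Lemma ev1_equivariant : {morph ev1 : g / path_reversal g >-> conf2_swap X g}.
Proof.
move=> g; apply/val_inj; rewrite /= /ev /= set_valE /=.
by rewrite unit_onem0 unit_onem1.
Qed.

Definition ev2 : orbit_space path_reversal -> orbit_space (conf2_swap X) :=
  orbit_map path_reversal (conf2_swap X) ev1.

Lemma ev2E (g : path_space1) :
  ev2 (orbit_proj path_reversal g) = orbit_proj (conf2_swap X) (ev1 g).
Proof. exact/orbit_mapE/ev1_equivariant. Qed.

End paths.

Definition is_TCS (R : realType) (X : topologicalType) (k : nat) :=
  exists2 g, is_genus (@ev2 R X) g & k = (g + 1)%N.

(* Main.v *)
(** Write [P] for the projective space and call a pair of unit vectors spanning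
    two different lines a frame; [flip] exchanges its vectors and [negr] negates
    the second one, and they generate a dihedral group of order 8.  An unordered
    pair of lines admits two preferred motions (the two chords between unit
    vectors), and choosing one of them amounts to choosing the sign of a
    function on frames that is invariant under [flip] and odd under [negr]:
    conversely the sign is recovered from an arbitrary symmetric motion planner
    by lifting its paths to the sphere.  Multiplied by the distance to the
    complement of the domain, these signs become continuous, so the genus of
    [ev2] is the least number of such functions without common zero.
    Coordinates of equivariant maps from the configuration space to a sphere are
    instead odd under [flip] and invariant under [negr].  The map
    [(u, v) |-> (u + v, u - v)], normalized, exchanges the two symmetry types. *)

Require Import Defs.
From HB Require Import structures.
From mathcomp Require Import all_boot all_order all_algebra generic_quotient.
From mathcomp Require Import all_classical reals topology normedtype realfun.
From mathcomp Require Import ring lra.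

Set Implicit Arguments.
Unset Strict Implicit.
Unset Printing Implicit Defensive.

Import Order.TTheory GRing.Theory Num.Theory.
Import numFieldNormedType.Exports.

Local Open Scope classical_set_scope.
Local Open Scope ring_scope.
Local Open Scope quotient_scope.

(** * Open maps and orbit projections *)

Definition open_map (A B : topologicalType) (q : A -> B) :=
  forall a V, nbhs a V -> nbhs (q a) (q @` V).

(** Openness, unlike being a quotient map, lets continuity descend at a single point and is stable
    under products. The projections [line], [conf] and [conf_orbit] below are all open. *)
Lemma open_map_continuous_at (A B C : topologicalType) (q : A -> B)
    (f : B -> C) (a : A) :
  open_map q -> {for a, continuous (f \o q)} -> {for q a, continuous f}.
Proof.
move=> oq cf V /cf Va; have := oq _ _ Va.
by apply: filterS => _ [c Vc <-].
Qed.

Lemma open_map_continuous (A B C : topologicalType) (q : A -> B) (f : B -> C) :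
  open_map q -> (forall b, exists a, q a = b) -> continuous (f \o q) ->
  continuous f.
Proof.
move=> oq sq cf b; have [a <-] := sq b.
exact: (open_map_continuous_at oq (cf a)).
Qed.

Lemma open_map_open (A B : topologicalType) (q : A -> B) (O : set A) :
  open_map q -> open O -> open (q @` O).
Proof.
move=> oq; rewrite !openE => oO _ [a Oa <-].
by apply: oq; exact: oO.
Qed.

Lemma open_map_comp (A B C : topologicalType) (q : A -> B) (p : B -> C) :
  open_map q -> open_map p -> open_map (p \o q).
Proof. by move=> oq op a V /oq/op; rewrite image_comp. Qed.

Lemma open_map_prod (A B A' B' : topologicalType) (q : A -> B) (p : A' -> B') :
  open_map q -> open_map p -> open_map (fun x : A * A' => (q x.1, p x.2)).
Proof.
move=> oq op [a a'] W [[U V] /= [aU aV] UVW].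
exists (q @` U, p @` V); first by split; [exact: oq|exact: op].
by move=> [_ _] [/= [x Ux <-] [y Vy <-]]; exists (x, y) => //; exact: UVW.
Qed.

Lemma open_map_id (A : topologicalType) : open_map (@id A).
Proof. by move=> a V; rewrite image_id. Qed.

Lemma orbit_proj_continuous (T : topologicalType) (tau : free_involution T) :
  continuous (orbit_proj tau).
Proof. exact: pi_continuous. Qed.

(** The saturation of an open set is the union of its two translates under the action, hence
    open. *)
Lemma orbit_proj_open (T : topologicalType) (tau : free_involution T) :
  open_map (orbit_proj tau).
Proof.
move=> a V; rewrite nbhsE => -[O [oO Oa] OV].
suff : nbhs (orbit_proj tau a) (orbit_proj tau @` O).
  by apply: filterS; exact: image_subset.
apply: open_nbhs_nbhs; split; last by exists a.
rewrite /open /= /quotient_open.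
have -> : \pi_(orbit_space tau) @^-1` (orbit_proj tau @` O) = O `|` tau @^-1` O.
  apply/seteqP; split => x /=.
    by move=> [y Oy /orbit_projP[<-|e]]; [left|right; rewrite /= -e].
  by move=> [Ox|Ox]; [exists x|exists (tau x) => //; apply/orbit_projP; right].
apply: openU => //; apply: open_comp => // x _.
exact: Defs.inv_continuous.
Qed.

Lemma orbit_proj_surj (T : topologicalType) (tau : free_involution T) b :
  exists a, orbit_proj tau a = b.
Proof. by exists (repr b); exact: reprK. Qed.

Lemma set_type_nbhs (T : topologicalType) (A : set T) (a : A) (V : set A) :
  nbhs a V <-> exists2 W, nbhs (set_val a) W & set_val @^-1` W `<=` V.
Proof.
split=> [[_ [[W oW <-] Wa WV]]|[W aW WV]].
  by exists W => //; exact: open_nbhs_nbhs.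
by apply: filterS WV _; exact: set_val_continuous.
Qed.

Lemma continuous_pair (T U V : topologicalType) (f : T -> U) (g : T -> V) (t : T) :
  {for t, continuous f} -> {for t, continuous g} ->
  {for t, continuous (fun x => (f x, g x))}.
Proof. by move=> cf cg; apply: cvg_pair. Qed.

Lemma sum_continuous (R : realType) (T : topologicalType) (I : Type) (s : seq I)
    (f : I -> T -> R) (t : T) : (forall i, {for t, continuous (f i)}) ->
  {for t, continuous (fun x => \sum_(i <- s) f i x)}.
Proof.
move=> cf; elim: s => [|i s IH].
  have -> : (fun x => \sum_(i <- [::]) f i x) = cst 0.
    by apply/funext => x; rewrite big_nil.
  exact: cst_continuous.
have -> : (fun x => \sum_(j <- i :: s) f j x) =
          (fun x => f i x + \sum_(j <- s) f j x).
  by apply/funext => x; rewrite big_cons.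
exact: continuousD.
Qed.

(** * Inner product and normalization of vectors *)

Section dot.
Variables (R : realType) (n : nat).
Implicit Types (x y z : 'rV[R]_n.+1).

Definition dot x y : R := \sum_i x ord0 i * y ord0 i.

Lemma dotC x y : dot x y = dot y x.
Proof. by apply: eq_bigr => i _; rewrite mulrC. Qed.

Lemma dotDl x y z : dot (x + y) z = dot x z + dot y z.
Proof. by rewrite -big_split; apply: eq_bigr => i _; rewrite mxE mulrDl. Qed.

Lemma dotDr x y z : dot z (x + y) = dot z x + dot z y.
Proof. by rewrite !(dotC z) dotDl. Qed.

Lemma dotZl k x y : dot (k *: x) y = k * dot x y.
Proof. by rewrite mulr_sumr; apply: eq_bigr => i _; rewrite mxE mulrA. Qed.

Lemma dotZr k x y : dot x (k *: y) = k * dot x y.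
Proof. by rewrite !(dotC x) dotZl. Qed.

Lemma dotNl x y : dot (- x) y = - dot x y.
Proof. by rewrite -scaleN1r dotZl mulN1r. Qed.

Lemma dotNr x y : dot x (- y) = - dot x y.
Proof. by rewrite !(dotC x) dotNl. Qed.

Lemma dot_ge0 x : 0 <= dot x x.
Proof. by apply: sumr_ge0 => i _; rewrite -expr2 sqr_ge0. Qed.

Lemma dot_eq0 x : dot x x = 0 -> x = 0.
Proof.
move=> /eqP; rewrite psumr_eq0 => [/allP x0|i _]; last by rewrite -expr2 sqr_ge0.
apply/rowP => i; have /x0 /= := mem_index_enum i.
by rewrite mulf_eq0 orbb mxE => /eqP.
Qed.

Lemma dot_gt0 x : x != 0 -> 0 < dot x x.
Proof. by move=> x0; rewrite lt_def dot_ge0 andbT; apply: contra_neq x0 => /dot_eq0. Qed.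

Lemma dot_continuous (T : topologicalType) (f g : T -> 'rV[R]_n.+1) (t : T) :
  {for t, continuous f} -> {for t, continuous g} ->
  {for t, continuous (fun s => dot (f s) (g s))}.
Proof.
move=> cf cg; apply: sum_continuous => i; apply: continuousM.
- apply: (continuous_comp (g := fun M : 'rV[R]_n.+1 => M ord0 i) cf).
  exact: coord_continuous.
- apply: (continuous_comp (g := fun M : 'rV[R]_n.+1 => M ord0 i) cg).
  exact: coord_continuous.
Qed.

Lemma dot_sphereP (u : sphere R n) : dot (set_val u) (set_val u) = 1.
Proof. by case: u => u uS; have /= := set_mem uS. Qed.

Lemma sphere_eq (u v : sphere R n) : set_val u = set_val v -> u = v.
Proof. exact: val_inj. Qed.

Lemma sphere_point_subproof :
  delta_mx ord0 ord0 \in [set x : 'rV[R]_n.+1 | \sum_i x ord0 i ^+ 2 = 1].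
Proof.
apply/mem_set => /=; rewrite (bigD1 ord0)//= mxE eqxx expr1n big1 ?addr0// => i.
by move=> i0; rewrite mxE (negPf i0) andbF expr0n.
Qed.

Lemma normalize_subproof x : x != 0 ->
  (Num.sqrt (dot x x))^-1 *: x \in [set x : 'rV[R]_n.+1 | \sum_i x ord0 i ^+ 2 = 1].
Proof.
move=> x0; apply/mem_set => /=; set k := _^-1.
have -> : \sum_i (k *: x) ord0 i ^+ 2 = dot (k *: x) (k *: x) by [].
rewrite dotZl dotZr mulrA -expr2 exprVn sqr_sqrtr ?dot_ge0// mulVf//.
by rewrite gt_eqF// dot_gt0.
Qed.

(* The value at 0 is an arbitrary point of the sphere. *)
Definition normalize x : sphere R n :=
  if pselect (x != 0) is left x0 then SigSub (normalize_subproof x0)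
  else SigSub sphere_point_subproof.

Lemma normalizeE x : x != 0 ->
  set_val (normalize x) = (Num.sqrt (dot x x))^-1 *: x.
Proof. by move=> x0; rewrite /normalize; case: pselect. Qed.

Lemma normalizeN x : x != 0 -> normalize (- x) = antipode R n (normalize x).
Proof.
move=> x0; apply: sphere_eq; rewrite set_valE /= -!set_valE.
by rewrite !normalizeE ?oppr_eq0// dotNl dotNr opprK scalerN.
Qed.

(** The case distinction in [normalize] does no harm near [t]: the length stays positive there, so
    the explicit formula holds on a neighbourhood. *)
Lemma continuous_normalize (T : topologicalType) (f : T -> 'rV[R]_n.+1) (t : T) :
  f t != 0 -> {for t, continuous f} -> {for t, continuous (normalize \o f)}.
Proof.
move=> ft0 cf V /set_type_nbhs[W tW WV].
have f0 : \forall s \near t, f s != 0.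
  have c := dot_continuous cf cf.
  have : \forall s \near t, 0 < dot (f s) (f s).
    exact: (c [set k | 0 < k] (lt_nbhsr (dot_gt0 ft0))).
  apply: filterS => s; apply: contraTneq => ->.
  by rewrite /dot big1 ?ltxx// => i _; rewrite mxE mul0r.
have : {for t, continuous (fun s : T => (Num.sqrt (dot (f s) (f s)))^-1 *: f s)}.
  apply: continuousZ => //; apply: continuousV.
    by rewrite gt_eqF// sqrtr_gt0 dot_gt0.
  by apply: (continuous_comp (dot_continuous cf cf)); exact: sqrt_continuous.
move=> /(_ W); rewrite /= -(normalizeE ft0) => /(_ tW).
apply: filterS2 f0 => s fs0 Ws; apply: WV.
by rewrite /= normalizeE.
Qed.

Lemma sphere_val_continuous : continuous (set_val : sphere R n -> 'rV[R]_n.+1).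
Proof. exact: set_val_continuous. Qed.

Lemma antipodeE (u : sphere R n) : set_val (antipode R n u) = - set_val u.
Proof. by []. Qed.

(** The squared distance of two unit vectors is 2 minus twice their inner product. *)
Lemma sphere_dot1 (u v : sphere R n) : dot (set_val u) (set_val v) = 1 -> u = v.
Proof.
move=> uv; apply/sphere_eq/eqP; rewrite -subr_eq0; apply/eqP/dot_eq0.
by rewrite dotDl !dotDr !dotNl !dotNr !dot_sphereP (dotC (set_val v)) uv; ring.
Qed.

Lemma sphere_sqr_dot1 (u v : sphere R n) :
  dot (set_val u) (set_val v) ^+ 2 = 1 -> u = v \/ u = antipode R n v.
Proof.
move=> /eqP; rewrite sqrf_eq1 => /orP[]/eqP uv; [left|right].
  exact: sphere_dot1.
by apply: sphere_dot1; rewrite antipodeE dotNr uv opprK.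
Qed.

Lemma sqr_dot_le1 (u v : sphere R n) : dot (set_val u) (set_val v) ^+ 2 <= 1.
Proof.
set d := dot _ _.
(* Cauchy-Schwarz: the component of [u] orthogonal to [v] has squared length [1 - d ^+ 2]. *)
have := dot_ge0 (set_val u - d *: set_val v).
rewrite dotDl !dotDr !dotNl !dotNr !dotZl !dotZr !dot_sphereP (dotC (set_val v)).
by rewrite -/d; nra.
Qed.

End dot.

(** * Lines and the angle between them *)

Section projective.
Variables (R : realType) (r : nat).
Local Notation S := (sphere R r).
Local Notation P := (projective_space R r).

Definition line : S -> P := orbit_proj (antipode R r).

Lemma lineP (u v : S) : line u = line v <-> u = v \/ u = antipode R r v.
Proof. exact: orbit_projP. Qed.

Lemma lineN (u : S) : line (antipode R r u) = line u.
Proof. by apply/lineP; right. Qed.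

Lemma line_surj (x : P) : exists u, line u = x.
Proof. exact: orbit_proj_surj. Qed.

Lemma line_continuous : continuous line.
Proof. exact: orbit_proj_continuous. Qed.

Lemma line_open : open_map line.
Proof. exact: orbit_proj_open. Qed.

(** The squared cosine of the angle between two lines; the square makes it independent of the chosen
    unit vectors. It stands in for a metric: the value 1 means equality, and positivity means that
    the lines are not orthogonal. *)
Definition cos2 (x y : P) : R := dot (set_val (repr x)) (set_val (repr y)) ^+ 2.

Lemma line_repr (u : S) :
  repr (line u) = u \/ repr (line u) = antipode R r u.
Proof. by apply/lineP; rewrite /line /orbit_proj reprK. Qed.

Lemma cos2E (u v : S) : cos2 (line u) (line v) = dot (set_val u) (set_val v) ^+ 2.
Proof.
rewrite /cos2; case: (line_repr u) => ->; case: (line_repr v) => ->;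
  by rewrite ?antipodeE ?dotNl ?dotNr ?sqrrN.
Qed.

Lemma cos2_eq1 (x y : P) : cos2 x y = 1 <-> x = y.
Proof.
have [u <-] := line_surj x; have [v <-] := line_surj y; rewrite cos2E; split.
  by move=> /sphere_sqr_dot1 /lineP.
by move=> /lineP[]->; rewrite ?antipodeE ?dotNl dot_sphereP ?sqrrN expr1n.
Qed.

Lemma cos2_le1 (x y : P) : cos2 x y <= 1.
Proof. exact: sqr_dot_le1. Qed.

Lemma cos2C (x y : P) : cos2 x y = cos2 y x.
Proof. by rewrite /cos2 dotC. Qed.

Lemma cos2_continuous : continuous (fun p : P * P => cos2 p.1 p.2).
Proof.
apply: (@open_map_continuous (S * S)%type _ _ (fun a => (line a.1, line a.2))).
- by apply: open_map_prod; exact: line_open.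
- by move=> [x y]; have [u <-] := line_surj x; have [v <-] := line_surj y; exists (u, v).
have -> : (fun p : P * P => cos2 p.1 p.2) \o (fun a : S * S => (line a.1, line a.2)) =
   (fun a : S * S => dot (set_val a.1) (set_val a.2) ^+ 2).
  by apply/funext => a /=; rewrite cos2E.
move=> a; have c : {for a, continuous (fun b : S * S => dot (set_val b.1) (set_val b.2))}.
  apply: dot_continuous.
    by apply: (@continuous_comp _ _ _ fst); [exact: cvg_fst|exact: sphere_val_continuous].
  by apply: (@continuous_comp _ _ _ snd); [exact: cvg_snd|exact: sphere_val_continuous].
by have := continuousM c c.
Qed.

(* Arbitrary when the line and the vector are orthogonal. *)
Definition acute (p : P * S) : S :=
  if 0 < dot (set_val (repr p.1)) (set_val p.2) then repr p.1
  else antipode R r (repr p.1).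

Lemma acute_line p : line (acute p) = p.1.
Proof.
have e : line (repr p.1) = p.1 by exact: reprK.
by rewrite /acute; case: ifP => _ //; rewrite lineN.
Qed.

Lemma acuteE (u v : S) : 0 < dot (set_val u) (set_val v) -> acute (line u, v) = u.
Proof.
rewrite /acute /=; case: (line_repr u) => -> => [->//|uv].
rewrite antipodeE dotNl oppr_gt0 ltNge (ltW uv) /=.
exact: (inv_involutive (antipode R r)).
Qed.

Lemma cos2_gt0P (x : P) (v : S) : 0 < cos2 x (line v) ->
  exists2 u, line u = x & 0 < dot (set_val u) (set_val v).
Proof.
have [u <-] := line_surj x; rewrite cos2E => uv.
have [uv0|uv0] := ltP 0 (dot (set_val u) (set_val v)); first by exists u.
exists (antipode R r u); first exact: lineN.
rewrite antipodeE dotNl oppr_gt0 lt_neqAle uv0 andbT.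
by move: uv; apply: contraTneq => ->; rewrite expr0n ltxx.
Qed.

(** Near a pair with positive inner product, [acute] composed with the open map
    [(u, v) |-> (line u, v)] is the first projection. So [acute] provides continuous local sections
    of the double cover [line]. *)
Lemma acute_continuous (p : P * S) : 0 < cos2 p.1 (line p.2) ->
  {for p, continuous acute}.
Proof.
case: p => x v /= /cos2_gt0P[u <- uv].
apply: (@open_map_continuous_at (S * S)%type _ _ (fun a => (line a.1, a.2)) _ (u, v)).
  exact: (@open_map_prod S P S S line id (@line_open) (@open_map_id S)).
have c : {for (u, v), continuous (fun b : S * S => dot (set_val b.1) (set_val b.2))}.
  apply: dot_continuous.
    by apply: (@continuous_comp _ _ _ fst); [exact: cvg_fst|exact: sphere_val_continuous].
  by apply: (@continuous_comp _ _ _ snd); [exact: cvg_snd|exact: sphere_val_continuous].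
have near_acute : \forall b \near (u, v), acute (line b.1, b.2) = b.1.
  have : \forall b \near (u, v), 0 < dot (set_val b.1) (set_val b.2).
    exact: (c [set k | 0 < k] (lt_nbhsr uv)).
  by apply: filterS => b; exact: acuteE.
move=> V; rewrite /= acuteE// => uV.
have : \forall b \near (u, v), V b.1 by apply: cvg_fst.
by apply: filterS2 near_acute => b /= ->.
Qed.

End projective.

(** * Topology of the unit interval *)

Section interval.
Variable R : realType.
Local Notation I := (unit_interval R).

Lemma unit_interval_itv (t : I) : 0 <= set_val t <= 1.
Proof. by case: t => t tI; have := set_mem tI; rewrite /= in_itv. Qed.

Lemma clamp_subproof (t : R) : Num.max 0 (Num.min t 1) \in `[0 : R, 1 : R]%classic.
Proof.
by apply/mem_set; rewrite /= in_itv /= le_max lexx ge_max ge_min ler01 lexx orbT.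
Qed.

(** A retraction of the real line onto the interval, through which compactness and connectedness
    pass from the segment to the type [unit_interval]. *)
Definition clamp (t : R) : I := SigSub (clamp_subproof t).

Lemma clampK (t : I) : clamp (set_val t) = t.
Proof.
apply: val_inj => /=; rewrite set_valE /=.
by have /andP[t0 t1] := unit_interval_itv t; rewrite min_l// max_r.
Qed.

Lemma clamp_continuous : continuous clamp.
Proof.
apply: set_type_continuous => t.
have -> : set_val \o clamp = fun t : R => Num.max 0 (Num.min t 1) by [].
apply: (@continuous_max R R (cst 0) (fun t => Num.min t 1) t).
  exact: cst_continuous.
by apply: (@continuous_min R R id (cst 1) t); [exact: cvg_id|exact: cst_continuous].
Qed.

Lemma clamp_image : clamp @` `[0, 1] = [set: I].
Proof.
apply/seteqP; split => // t _; exists (set_val t); last exact: clampK.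
by rewrite /= in_itv unit_interval_itv.
Qed.

Lemma unit_interval_compact : compact [set: I].
Proof.
rewrite -clamp_image; apply: continuous_compact; last exact: segment_compact.
by apply: continuous_subspaceT; exact: clamp_continuous.
Qed.

Lemma unit_interval_connected : connected [set: I].
Proof.
rewrite -clamp_image; apply: connected_continuous_connected.
  exact: segment_connected.
by apply: continuous_subspaceT; exact: clamp_continuous.
Qed.

Lemma unit_interval_hausdorff : hausdorff_space I.
Proof.
move=> s t st; apply: val_inj; rewrite -!set_valE.
apply: (@norm_hausdorff R R) => A B As Bt.
have [x [Ax Bx]] := st _ _ (set_val_continuous As) (set_val_continuous Bt).
by exists (set_val x).
Qed.

Lemma unit_interval_locally_compact : locally_compact [set: I].
Proof.
move=> t _; exists setT; first exact: filterT.
by split; [exact: unit_interval_compact|exact: closedT].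
Qed.

(** Connectedness as an induction principle: a locally constant property has a clopen truth set. *)
Lemma unit_interval_ind (Q : I -> Prop) :
  (forall t, \forall s \near t, Q s <-> Q t) -> Q (unit0 R) -> forall t, Q t.
Proof.
move=> Qloc Q0 t.
have oQ : open [set t | Q t].
  by rewrite openE => s Qs; have := Qloc s; apply: filterS => u [_]; apply.
have cQ : closed [set t | Q t].
  rewrite -openC openE => s nQs; have := Qloc s.
  by apply: filterS => u [+ _] Qu; move/(_ Qu).
suff : [set t | Q t] = setT by move=> e; rewrite -[Q t]/([set t | Q t] t) e.
apply: unit_interval_connected; first by exists (unit0 R).
  by exists [set t | Q t] => //; rewrite setTI.
by exists [set t | Q t] => //; rewrite setTI.
Qed.

Lemma unit_mul_subproof (s t : I) : set_val s * set_val t \in `[0 : R, 1 : R]%classic.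
Proof.
apply/mem_set; rewrite /= in_itv /=.
have /andP[s0 s1] := unit_interval_itv s; have /andP[t0 t1] := unit_interval_itv t.
by rewrite mulr_ge0//= mulr_ile1.
Qed.

(** The contraction of the interval to its left end, which shrinks a path to a constant one in
    [lift_exists]. *)
Definition unit_mul (s t : I) : I := SigSub (unit_mul_subproof s t).

Lemma unit_mul0 t : unit_mul (unit0 R) t = unit0 R.
Proof. by apply: val_inj; rewrite /= !set_valE /= mul0r. Qed.

Lemma unit_mul1 t : unit_mul (unit1 R) t = t.
Proof. by apply: val_inj; rewrite /= !set_valE /= mul1r. Qed.

Lemma unit_mul_continuous : continuous (fun p : I * I => unit_mul p.1 p.2).
Proof.
apply: set_type_continuous => p.
have -> : set_val \o (fun p : I * I => unit_mul p.1 p.2) =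
    fun p : I * I => set_val p.1 * set_val p.2 by [].
apply: (@continuousM R _ (fun p : I * I => set_val p.1) (fun p : I * I => set_val p.2) p).
  by apply: (@continuous_comp _ _ _ fst); [exact: cvg_fst|exact: set_val_continuous].
by apply: (@continuous_comp _ _ _ snd); [exact: cvg_snd|exact: set_val_continuous].
Qed.

End interval.

(** * Lifting paths from projective space to the sphere *)

Section lifting.
Variables (R : realType) (r : nat).
Local Notation I := (unit_interval R).
Local Notation S := (sphere R r).
Local Notation P := (projective_space R r).

(** Continuity gives a neighbourhood for each [t], and compactness of the interval makes it uniform
    in [t]. The parameter space is the interval itself in [lift_exists] and the path space in
    [function_of_section]. *)
Lemma near_nonorthogonal (T : topologicalType) (H : T * I -> P) (a : T) :
  continuous H ->
  \forall b \near a, forall t, 0 < cos2 (H (b, t)) (H (a, t)).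
Proof.
move=> cH.
have /compact_near_coveringP/(_ _ (nbhs a)) := @unit_interval_compact R.
move=> /(_ (fun b t => 0 < cos2 (H (b, t)) (H (a, t))) _) HP.
suff : \forall b \near a, [set: I] `<=` (fun t => 0 < cos2 (H (b, t)) (H (a, t))).
  by apply: filterS => b + t; apply.
apply: HP => t _.
have c : {for (t, a), continuous (fun p : I * T => cos2 (H (p.2, p.1)) (H (a, p.1)))}.
  apply: (@continuous_comp _ _ _ (fun p : I * T => (H (p.2, p.1), H (a, p.1)))
    (fun q => cos2 q.1 q.2)); last exact: cos2_continuous.
  apply: continuous_pair.
    apply: (@continuous_comp _ _ _ (fun p : I * T => (p.2, p.1)) H); last exact: cH.
    exact: swap_continuous.
  apply: (@continuous_comp _ _ _ (fun p : I * T => (a, p.1)) H); last exact: cH.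
  by apply: continuous_pair; [exact: cvg_cst|exact: cvg_fst].
have c1 : 0 < cos2 (H (a, t)) (H (a, t)).
  by have /cos2_eq1 -> := erefl (H (a, t)); exact: ltr01.
exact: (c [set k | 0 < k] (lt_nbhsr c1)).
Qed.

Definition lifts (g : I -> S) (gamma : I -> P) :=
  continuous g /\ forall t, line (g t) = gamma t.

(** A lift of one path guides a lift of any path that is nowhere orthogonal to it: at each time the
    unit vector nearer to the given lift is taken. *)
Lemma lifts_acute (g : I -> S) (gamma delta : I -> P) :
  continuous delta -> lifts g gamma ->
  (forall t, 0 < cos2 (delta t) (gamma t)) ->
  lifts (fun t => acute (delta t, g t)) delta.
Proof.
move=> cd [cg gP] dg; split=> [t|t]; last by rewrite acute_line.
apply: (@continuous_comp _ _ _ (fun t => (delta t, g t)) (@acute R r)).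
  by apply: continuous_pair; [exact: cd|exact: cg].
by apply: acute_continuous; rewrite /= gP.
Qed.

(* Liftability of the shrunk path [t |-> gamma (s t)] is locally constant in s,
   and holds at s = 0. *)
Lemma lift_exists (gamma : I -> P) : continuous gamma -> exists g, lifts g gamma.
Proof.
move=> cg.
suff /(_ (unit1 R)) : forall s, exists g, lifts g (fun t => gamma (unit_mul s t)).
  by move=> [g [gc gP]]; exists g; split=> // t; rewrite gP unit_mul1.
have cH : continuous (fun p : I * I => gamma (unit_mul p.1 p.2)).
  move=> p; apply: (@continuous_comp _ _ _ (fun p : I * I => unit_mul p.1 p.2)).
    exact: unit_mul_continuous.
  exact: cg.
have cs s : continuous (fun t => gamma (unit_mul s t)).
  move=> t; apply: (@continuous_comp _ _ _ (fun t => (s, t))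
    (fun p : I * I => gamma (unit_mul p.1 p.2))); last exact: cH.
  by apply: continuous_pair; [exact: cst_continuous|exact: cvg_id].
apply: unit_interval_ind => [s|].
  have := near_nonorthogonal s cH; apply: filterS => s' /= ss'.
  (* Non-orthogonality is symmetric, so lifts pass both ways between [s] and [s']. *)
  split=> -[g gl]; eexists; apply: (lifts_acute _ gl); try exact: cs; last exact: ss'.
  by move=> t; rewrite cos2C.
have [u uP] := line_surj (gamma (unit0 R)).
exists (cst u); split=> [|t]; first exact: cst_continuous.
by rewrite unit_mul0.
Qed.

(** The inner product of two lifts is continuous with values 1 and -1, so their agreement is locally
    constant. *)
Lemma lift_unique (g g' : I -> S) (gamma : I -> P) :
  lifts g gamma -> lifts g' gamma -> g (unit0 R) = g' (unit0 R) ->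
  forall t, g t = g' t.
Proof.
move=> [cg gP] [cg' gP'] e0; apply: unit_interval_ind => // t.
pose f s := dot (set_val (g s)) (set_val (g' s)).
have fE s : g s = g' s <-> 0 < f s.
  have /lineP : line (g s) = line (g' s) by rewrite gP gP'.
  rewrite /f => -[->|->]; rewrite ?antipodeE ?dotNl dot_sphereP ?ltr01//.
  by split=> [/inv_free//|]; rewrite ltr0N1.
have fE' s : g s <> g' s <-> f s < 0.
  have /lineP : line (g s) = line (g' s) by rewrite gP gP'.
  rewrite /f => -[->|->]; rewrite ?antipodeE ?dotNl dot_sphereP; split => //.
  - by rewrite ltr10.
  - by rewrite ltrN10.
  - by move=> _ /inv_free.
have c : {for t, continuous f}.
  apply: dot_continuous.
    by apply: (@continuous_comp _ _ _ g (set_val : S -> 'rV[R]_r.+1));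
      [exact: cg|exact: sphere_val_continuous].
  by apply: (@continuous_comp _ _ _ g' (set_val : S -> 'rV[R]_r.+1));
    [exact: cg'|exact: sphere_val_continuous].
have [e|ne] := pselect (g t = g' t).
  have /fE ft := e.
  have : \forall s \near t, 0 < f s by exact: (c [set k | 0 < k] (lt_nbhsr ft)).
  by apply: filterS => s /fE.
have /fE' ft := ne.
have : \forall s \near t, f s < 0 by exact: (c [set k | k < 0] (lt_nbhsl ft)).
by apply: filterS => s /fE'.
Qed.

(** For unit vectors on the end lines of a path, exactly one of [v] and its antipode is joined to
    [u] ([joined_total], [joined_antipode]). This is the sign that a path attaches to a frame. *)
Definition joined (gamma : I -> P) (u v : S) :=
  exists g, [/\ lifts g gamma, g (unit0 R) = u & g (unit1 R) = v].

Lemma joined_rev gamma u v : joined gamma u v ->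
  joined (gamma \o @unit_onem R) v u.
Proof.
move=> [g [[cg gP] <- <-]]; exists (g \o @unit_onem R); split => /=.
- split=> [t|t /=]; last by rewrite gP.
  by apply: continuous_comp; [exact: unit_onem_continuous|exact: cg].
- by rewrite unit_onem0.
- by rewrite unit_onem1.
Qed.

Lemma joined_total gamma u v : continuous gamma ->
  line u = gamma (unit0 R) -> line v = gamma (unit1 R) ->
  joined gamma u v \/ joined gamma u (antipode R r v).
Proof.
move=> /lift_exists[g gl] u0 v1.
have [g' [gl' g'0]] : exists g', lifts g' gamma /\ g' (unit0 R) = u.
  have /lineP[e|e] : line u = line (g (unit0 R)) by rewrite u0 gl.2.
    by exists g; rewrite e.
  exists (antipode R r \o g); rewrite e; split => //.
  split=> [t|t /=]; last by rewrite lineN gl.2.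
  by apply: continuous_comp; [exact: gl.1|exact: Defs.inv_continuous].
have /lineP[e|e] : line (g' (unit1 R)) = line v by rewrite v1 gl'.2.
  by left; exists g'.
by right; exists g'.
Qed.

Lemma joined_antipode gamma u v : joined gamma u v ->
  ~ joined gamma u (antipode R r v).
Proof.
move=> [g [gl g0 g1]] [g' [gl' g0' g1']].
have := lift_unique gl gl'; rewrite g0 g0' => /(_ erefl (unit1 R)).
by rewrite g1 g1' => /esym/inv_free.
Qed.

(** The sign survives small perturbations: the acute lift along [g] starts and ends at the unit
    vectors forming acute angles with [u] and [v], which are [u'] and [v']. *)
Lemma joined_near (gamma delta : I -> P) (u v u' v' : S) :
  continuous delta -> joined gamma u v ->
  (forall t, 0 < cos2 (delta t) (gamma t)) ->
  line u' = delta (unit0 R) -> line v' = delta (unit1 R) ->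
  0 < dot (set_val u') (set_val u) -> 0 < dot (set_val v') (set_val v) ->
  joined delta u' v'.
Proof.
move=> cd [g [gl g0 g1]] gd u0 v1 uu vv.
exists (fun t => acute (delta t, g t)); split.
- exact: (lifts_acute cd gl).
- by rewrite -u0 g0 acuteE.
- by rewrite -v1 g1 acuteE.
Qed.

End lifting.

(** * Frames, their dihedral symmetry and the passage to diagonals *)

Section frames.
Variables (R : realType) (r : nat).
Local Notation S := (sphere R r).
Local Notation P := (projective_space R r).
Local Notation anti := (antipode R r).

Definition frame : topologicalType :=
  set_type [set a : S * S | line a.1 <> line a.2].

Definition mkframe (u v : S) (uv : line u <> line v) : frame :=
  SigSub (mem_set uv : (u, v) \in [set a : S * S | line a.1 <> line a.2]).

Definition fr1 (a : frame) : S := (set_val a).1.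
Definition fr2 (a : frame) : S := (set_val a).2.

Lemma frameP (a : frame) : line (fr1 a) <> line (fr2 a).
Proof. by case: a => a aP; have := set_mem aP. Qed.

Lemma frame_eq (a b : frame) : fr1 a = fr1 b -> fr2 a = fr2 b -> a = b.
Proof.
move=> e1 e2; apply: val_inj; rewrite -!set_valE.
by rewrite (surjective_pairing (set_val a)) (surjective_pairing (set_val b)); congr pair.
Qed.

Lemma fr1_continuous : continuous fr1.
Proof.
move=> a; apply: (@continuous_comp _ _ _ (set_val : frame -> S * S) fst).
  exact: set_val_continuous.
exact: cvg_fst.
Qed.

Lemma fr2_continuous : continuous fr2.
Proof.
move=> a; apply: (@continuous_comp _ _ _ (set_val : frame -> S * S) snd).
  exact: set_val_continuous.
exact: cvg_snd.
Qed.

Lemma frame_continuous (T : topologicalType) (f : T -> frame) :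
  continuous (fr1 \o f) -> continuous (fr2 \o f) -> continuous f.
Proof.
move=> c1 c2; apply: set_type_continuous => t.
have -> : set_val \o f = fun t => (fr1 (f t), fr2 (f t)).
  by apply/funext => s /=; rewrite -surjective_pairing.
exact: (@continuous_pair T S S (fr1 \o f) (fr2 \o f) t (c1 t) (c2 t)).
Qed.

Definition flip (a : frame) : frame := mkframe (fun e => @frameP a (esym e)).

Lemma negr_subproof (a : frame) : line (fr1 a) <> line (anti (fr2 a)).
Proof. by rewrite lineN; exact: frameP. Qed.

Definition negr (a : frame) : frame := mkframe (@negr_subproof a).

Lemma flip1 a : fr1 (flip a) = fr2 a. Proof. by []. Qed.
Lemma flip2 a : fr2 (flip a) = fr1 a. Proof. by []. Qed.
Lemma negr1 a : fr1 (negr a) = fr1 a. Proof. by []. Qed.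
Lemma negr2 a : fr2 (negr a) = anti (fr2 a). Proof. by []. Qed.

Lemma flipK : involutive flip.
Proof. by move=> a; exact: frame_eq. Qed.

Lemma antiK : involutive anti.
Proof. exact: inv_involutive. Qed.

Lemma negrK : involutive negr.
Proof. by move=> a; apply: frame_eq => //; exact: antiK. Qed.

Lemma conf_subproof (a : frame) :
  (line (fr1 a), line (fr2 a)) \in ~` [set xy : P * P | xy.1 = xy.2].
Proof. by apply/mem_set; exact: frameP. Qed.

Definition conf (a : frame) : conf2 P := SigSub (conf_subproof a).

Lemma conf_flip a : conf (flip a) = conf2_swap P (conf a).
Proof. exact: val_inj. Qed.

Lemma conf_negr a : conf (negr a) = conf a.
Proof. by apply: val_inj => /=; rewrite lineN. Qed.

Lemma conf_continuous : continuous conf.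
Proof.
apply: set_type_continuous => a.
have -> : set_val \o conf = fun a => (line (fr1 a), line (fr2 a)) by [].
have c1 : {for a, continuous (@line R r \o fr1)}.
  by apply: continuous_comp; [exact: fr1_continuous|exact: line_continuous].
have c2 : {for a, continuous (@line R r \o fr2)}.
  by apply: continuous_comp; [exact: fr2_continuous|exact: line_continuous].
exact: (continuous_pair c1 c2).
Qed.

Lemma conf_open : open_map conf.
Proof.
move=> a V /set_type_nbhs[W aW WV]; apply/set_type_nbhs.
exists ((fun x : S * S => (line x.1, line x.2)) @` W).
  exact: (@open_map_prod _ _ _ _ _ _ (@line_open R r) (@line_open R r) _ _ aW).
move=> x /= [[u v] Wuv /= xE].
have uv : line u <> line v.
  by move=> e; case: x xE => x xP /= xE; have := set_mem xP; apply; rewrite -[x]xE.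
exists (mkframe uv); first exact: WV.
exact: val_inj.
Qed.

Lemma conf_surj x : exists a, conf a = x.
Proof.
case: x => -[x y] xy; have /= := set_mem xy.
have [u ux] := line_surj x; have [v vy] := line_surj y => xy'.
have uv : line u <> line v by rewrite ux vy.
by exists (mkframe uv); apply: val_inj => /=; rewrite ux vy.
Qed.

(** The fibres of [conf] are the orbits of the sign changes of the two vectors, so a property stable
    under both spreads over a fibre. *)
Lemma conf_fiber (Q : frame -> Prop) (a b : frame) :
  (forall c, Q c -> Q (negr c)) -> (forall c, Q c -> Q (flip (negr (flip c)))) ->
  conf a = conf b -> Q a -> Q b.
Proof.
move=> Qr Ql /(congr1 set_val) /= [/lineP e1 /lineP e2] Qa.
(* An intermediate frame, in which the first vector is already corrected and the second is not. *)
have [d Qd [d1 d2]] : exists2 d, Q d & fr1 d = fr1 b /\ fr2 d = fr2 a.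
  case: e1 => e; first by exists a.
  exists (flip (negr (flip a))); first exact: Ql.
  by rewrite flip1 flip2 negr1 negr2 flip1 flip2 e antiK.
case: e2 => e.
  by have -> : b = d by apply: frame_eq; rewrite ?d1// d2.
have -> : b = negr d; last exact: Qr.
by apply: frame_eq; rewrite ?negr1 ?negr2 ?d1// d2 e antiK.
Qed.

Definition conf_orbit (a : frame) : orbit_space (conf2_swap P) :=
  orbit_proj (conf2_swap P) (conf a).

Lemma conf_orbit_flip a : conf_orbit (flip a) = conf_orbit a.
Proof. by rewrite /conf_orbit conf_flip; apply/orbit_projP; right. Qed.

Lemma conf_orbit_negr a : conf_orbit (negr a) = conf_orbit a.
Proof. by rewrite /conf_orbit conf_negr. Qed.

Lemma conf_orbit_continuous : continuous conf_orbit.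
Proof.
move=> a; apply: (@continuous_comp _ _ _ conf (orbit_proj (conf2_swap P))).
  exact: conf_continuous.
exact: orbit_proj_continuous.
Qed.

Lemma conf_orbit_open : open_map conf_orbit.
Proof. exact: (open_map_comp conf_open (@orbit_proj_open _ (conf2_swap P))). Qed.

Lemma conf_orbit_surj b : exists a, conf_orbit a = b.
Proof.
have [x <-] := orbit_proj_surj b; have [a <-] := conf_surj x.
by exists a.
Qed.

(** The fibres of [conf_orbit] are the orbits of the whole dihedral group; the reversed pair is
    reached by one further [flip]. *)
Lemma conf_orbit_fiber (Q : frame -> Prop) (a b : frame) :
  (forall c, Q c -> Q (negr c)) -> (forall c, Q c -> Q (flip c)) ->
  conf_orbit a = conf_orbit b -> Q a -> Q b.
Proof.
move=> Qr Qf; have Ql c : Q c -> Q (flip (negr (flip c))) by move=> /Qf/Qr/Qf.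
move=> /orbit_projP[|]; first exact: conf_fiber.
rewrite -conf_flip => /(conf_fiber Qr Ql) Qab /Qab /Qf.
by rewrite flipK.
Qed.

Lemma frame_add_neq0 (a : frame) : set_val (fr1 a) + set_val (fr2 a) != 0.
Proof.
apply/eqP => e; apply: (@frameP a); apply/lineP; right; apply: sphere_eq.
by rewrite antipodeE; apply/eqP; rewrite -addr_eq0 e.
Qed.

Lemma frame_sub_neq0 (a : frame) : set_val (fr1 a) - set_val (fr2 a) != 0.
Proof. by have := frame_add_neq0 (negr a); rewrite antipodeE. Qed.

Definition sum_dir (a : frame) : S := normalize (set_val (fr1 a) + set_val (fr2 a)).
Definition diff_dir (a : frame) : S := normalize (set_val (fr1 a) - set_val (fr2 a)).

(** The diagonals of a rhombus are orthogonal, hence span different lines. *)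
Lemma diagonals_subproof (a : frame) : line (sum_dir a) <> line (diff_dir a).
Proof.
have orth : dot (set_val (fr1 a) + set_val (fr2 a)) (set_val (fr1 a) - set_val (fr2 a)) = 0.
  by rewrite dotDl !dotDr !dotNr !dot_sphereP (dotC (set_val (fr2 a))); ring.
move=> e; have := cos2E (sum_dir a) (diff_dir a).
rewrite e; have /cos2_eq1 -> := erefl (line (diff_dir a)).
rewrite !normalizeE ?frame_add_neq0 ?frame_sub_neq0// dotZl dotZr.
rewrite orth !mulr0 expr0n /=.
by move=> /eqP; rewrite oner_eq0.
Qed.

(* This realizes the outer automorphism of the dihedral group, which exchanges
   the classes of the reflections flip and negr. *)
Definition diagonals (a : frame) : frame := mkframe (@diagonals_subproof a).

Lemma diagonals1 a : fr1 (diagonals a) = sum_dir a. Proof. by []. Qed.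
Lemma diagonals2 a : fr2 (diagonals a) = diff_dir a. Proof. by []. Qed.

Lemma diagonals_flip a : diagonals (flip a) = negr (diagonals a).
Proof.
apply: frame_eq.
  by rewrite negr1 !diagonals1 /sum_dir flip1 flip2 addrC.
rewrite negr2 !diagonals2 /diff_dir flip1 flip2 -normalizeN ?frame_sub_neq0//.
by rewrite opprB.
Qed.

Lemma diagonals_negr a : diagonals (negr a) = flip (diagonals a).
Proof.
apply: frame_eq => //; rewrite flip2 diagonals2 diagonals1 /diff_dir /sum_dir.
by rewrite negr1 negr2 antipodeE opprK.
Qed.

Lemma diagonals_continuous : continuous diagonals.
Proof.
have c1 : continuous (fun a => set_val (fr1 a) : 'rV[R]_r.+1).
  move=> a; apply: (@continuous_comp _ _ _ fr1 (set_val : S -> 'rV[R]_r.+1)).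
    exact: fr1_continuous.
  exact: sphere_val_continuous.
have c2 : continuous (fun a => set_val (fr2 a) : 'rV[R]_r.+1).
  move=> a; apply: (@continuous_comp _ _ _ fr2 (set_val : S -> 'rV[R]_r.+1)).
    exact: fr2_continuous.
  exact: sphere_val_continuous.
apply: frame_continuous => a.
  have -> : fr1 \o diagonals = @normalize R r \o
      (fun b : frame => set_val (fr1 b) + set_val (fr2 b)) by [].
  apply: continuous_normalize; first exact: frame_add_neq0.
  by apply: continuousD; [exact: c1|exact: c2].
have -> : fr2 \o diagonals = @normalize R r \o
    (fun b : frame => set_val (fr1 b) - set_val (fr2 b)) by [].
apply: continuous_normalize; first exact: frame_sub_neq0.
by apply: continuousB; [exact: c1|exact: c2].
Qed.

End frames.

(** * Equivariant maps to spheres as families of odd functions *)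

Section level.
Variable R : realType.

(** The coordinates of an equivariant map to R^n without the origin. *)
Definition odd_family (T : topologicalType) (tau : free_involution T) n
    (k : 'I_n -> T -> R) :=
  [/\ forall i, continuous (k i), forall i x, k i (tau x) = - k i x
    & forall x, exists i, k i x != 0].

(** One direction takes coordinates, the other normalizes. The index shifts because [sphere R n]
    lies in R^(n+1). *)
Lemma equivariant_odd_family (T : topologicalType) (tau : free_involution T) n :
  (exists f : T -> sphere R n,
     continuous f /\ forall x, f (tau x) = antipode R n (f x)) <->
  exists k : 'I_n.+1 -> T -> R, odd_family tau k.
Proof.
split=> [[f [cf fM]]|[k [ck kM k0]]].
  exists (fun i x => set_val (f x) ord0 i); split=> [i x|i x|x].
  - apply: (@continuous_comp _ _ _ (fun x => set_val (f x) : 'rV[R]_n.+1)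
      (fun M : 'rV[R]_n.+1 => M ord0 i)); last exact: coord_continuous.
    apply: (@continuous_comp _ _ _ f (set_val : _ -> 'rV[R]_n.+1)); first exact: cf.
    exact: sphere_val_continuous.
  - by rewrite fM antipodeE mxE.
  - apply: contrapT => f0; have := dot_sphereP (f x); rewrite /dot big1; last first.
      move=> i _; have /eqP -> : set_val (f x) ord0 i == 0; last by rewrite mul0r.
      by apply/negPn/negP => fi; apply: f0; exists i.
    by move/esym/eqP; rewrite oner_eq0.
pose K x : 'rV[R]_n.+1 := \row_i k i x.
have K0 x : K x != 0.
  have [i] := k0 x; apply: contra_neq => /rowP/(_ i).
  by rewrite !mxE.
exists (@normalize R n \o K); split=> [x|x].
  apply: continuous_normalize => //.
  move=> V /nbhs_ballP[e e0 eV].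
  have : \forall y \near x, forall i, ball (k i x) e (k i y).
    apply: filter_forall => i; apply: (ck i x); exact: nbhsx_ballx.
  apply: filterS => y yk; apply: eV; split=> // i j.
  by rewrite !mxE.
transitivity (normalize (- K x)); last by rewrite normalizeN.
congr normalize.
by apply/rowP => i; rewrite !mxE kM.
Qed.

End level.

(** * Exchanging the two symmetry types *)

Section frame_family.
Variables (R : realType) (r : nat).
Local Notation S := (sphere R r).
Local Notation P := (projective_space R r).

Definition frame_family n (h : 'I_n -> frame R r -> R) :=
  [/\ forall i, continuous (h i), forall i a, h i (flip a) = h i a,
      forall i a, h i (negr a) = - h i a & forall a, exists i, h i a != 0].

(** Both directions precompose with [diagonals], which exchanges the two symmetry types. A family on
    frames then becomes even under each sign change and descends along [conf]. *)
Lemma odd_family_frame n :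
  (exists k : 'I_n -> conf2 P -> R, odd_family (conf2_swap P) k) <->
  exists h : 'I_n -> frame R r -> R, frame_family h.
Proof.
split=> [[k [ck kM k0]]|[h [ch hf hr h0]]].
  exists (fun i a => k i (conf (diagonals a))); split=> [i a|i a|i a|a].
  - apply: (@continuous_comp _ _ _ (@conf R r \o @diagonals R r)); last exact: ck.
    by apply: continuous_comp; [exact: diagonals_continuous|exact: conf_continuous].
  - by rewrite diagonals_flip conf_negr.
  - by rewrite diagonals_negr conf_flip kM.
  - exact: k0.
pose rep (x : conf2 P) := sval (cid (conf_surj x)).
have repK x : conf (rep x) = x by exact: (svalP (cid (conf_surj x))).
pose k i x := h i (diagonals (rep x)).
have kE i a : k i (conf a) = h i (diagonals a).
  apply/esym; apply: (@conf_fiber R r (fun c => h i (diagonals a) = h i (diagonals c)) a).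
  - by move=> c ->; rewrite diagonals_negr hf.
  (* Under [diagonals], negating the first vector becomes [negr], [flip], [negr] in succession, and
     the two signs cancel. *)
  - by move=> c ->; rewrite diagonals_flip diagonals_negr diagonals_flip !hr hf hr opprK.
  - by rewrite repK.
  - by [].
exists k; split=> [i|i x|x].
- apply: (open_map_continuous (@conf_open R r) (@conf_surj R r)).
  have -> : k i \o @conf R r = h i \o @diagonals R r by apply/funext => a /=.
  by move=> a; apply: continuous_comp; [exact: diagonals_continuous|exact: ch].
- by have [a <-] := conf_surj x; rewrite -conf_flip !kE diagonals_flip hr.
- by have [a <-] := conf_surj x; have [i hi] := h0 (diagonals a); exists i; rewrite kE.
Qed.

(* The coefficients of the difference of the orthogonal projections onto the
   two lines. *)
Lemma odd_family_exists :
  exists n, exists k : 'I_n -> conf2 P -> R, odd_family (conf2_swap P) k.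
Proof.
pose D := ('I_r.+1 * 'I_r.+1)%type.
pose c (d : D) (u : S) : R := set_val u ord0 d.1 * set_val u ord0 d.2.
pose p d (x : P) := c d (repr x).
have pE d u : p d (line u) = c d u.
  rewrite /p; case: (line_repr u) => -> //.
  by rewrite /c antipodeE !mxE mulrNN.
have cp d : continuous (p d).
  apply: (open_map_continuous (@line_open R r) (@line_surj R r)).
  have -> : p d \o @line R r = c d by apply/funext => u /=.
  have cc i : continuous (fun u : S => set_val u ord0 i : R).
    move=> u; apply: (@continuous_comp _ _ _ (set_val : S -> 'rV[R]_r.+1)
      (fun M : 'rV[R]_r.+1 => M ord0 i)); last exact: coord_continuous.
    exact: sphere_val_continuous.
  move=> u; exact: (continuousM (cc d.1 u) (cc d.2 u)).
exists #|{: D}|, (fun i x => p (enum_val i) (set_val x).1 - p (enum_val i) (set_val x).2).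
split=> [i|i x|x].
- have c1 : continuous (fun x : conf2 P => p (enum_val i) (set_val x).1).
    move=> x; apply: (@continuous_comp _ _ _ (fun x : conf2 P => (set_val x).1)); last exact: cp.
    apply: (@continuous_comp _ _ _ (set_val : conf2 P -> P * P) fst).
      exact: set_val_continuous.
    exact: cvg_fst.
  have c2 : continuous (fun x : conf2 P => p (enum_val i) (set_val x).2).
    move=> x; apply: (@continuous_comp _ _ _ (fun x : conf2 P => (set_val x).2)); last exact: cp.
    apply: (@continuous_comp _ _ _ (set_val : conf2 P -> P * P) snd).
      exact: set_val_continuous.
    exact: cvg_snd.
  by move=> x; apply: (continuousB (c1 x) (c2 x)).
- by rewrite opprB.
have [a <-] := conf_surj x; apply: contrapT => k0.
have e d : c d (fr1 a) = c d (fr2 a).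
  apply/eqP; rewrite -subr_eq0; apply/negPn/negP => d0; apply: k0.
  by exists (enum_rank d); rewrite enum_rankK /= !pE.
(* If all products of two coordinates agree on [u] and [v], then the squared inner product of [u]
   and [v] equals that of [v] with itself, which is 1. *)
apply: (@frameP _ _ a); apply/cos2_eq1; rewrite cos2E expr2.
set u := set_val (fr1 a); set v := set_val (fr2 a).
have vv : dot v v = 1 by exact: dot_sphereP.
transitivity (dot v v * dot v v); last by rewrite vv mulr1.
rewrite /dot !big_distrlr /=; apply: eq_bigr => i _; apply: eq_bigr => j _.
by have := e (i, j); rewrite /c /= -/u -/v => uv; rewrite mulrACA uv mulrACA.
Qed.

End frame_family.

(** * Motion along chords *)

Section chords.
Variables (R : realType) (r : nat).
Local Notation S := (sphere R r).
Local Notation P := (projective_space R r).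
Local Notation I := (unit_interval R).
Local Notation V := 'rV[R]_r.+1.

Definition chord_vec (p : frame R r * I) : V :=
  (1 - set_val p.2 : R) *: set_val (fr1 p.1) + (set_val p.2 : R) *: set_val (fr2 p.1).

(** With d the inner product of the two vectors, the squared length is (1 - s + s d)^2 + s^2 (1 -
    d^2), and d^2 < 1 because the lines differ. *)
Lemma chord_vec_neq0 p : chord_vec p != 0.
Proof.
case: p => a t; apply/eqP => /(congr1 (fun x : V => dot x x)).
rewrite /chord_vec /=; set s : R := set_val t.
set u := set_val (fr1 a); set v := set_val (fr2 a).
have d1 : dot u v ^+ 2 < 1.
  rewrite -cos2E lt_neqAle cos2_le1 andbT; apply/eqP => /cos2_eq1.
  exact: frameP.
have uu : dot u u = 1 by exact: dot_sphereP.
have vv : dot v v = 1 by exact: dot_sphereP.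
have -> : dot (0 : V) 0 = 0 by rewrite /dot big1// => i _; rewrite mxE mul0r.
rewrite dotDl !dotDr !dotZl !dotZr uu vv (dotC v) => e.
have [s0|s0] := eqVneq s 0; first by move: e; rewrite s0; lra.
have s2 : 0 < s ^+ 2 by rewrite exprn_even_gt0.
have : 0 < s ^+ 2 * (1 - dot u v ^+ 2) by rewrite mulr_gt0// subr_gt0.
have := sqr_ge0 (1 - s + s * dot u v).
by nra.
Qed.

Definition chord (p : frame R r * I) : P := line (normalize (chord_vec p)).

Lemma chord_continuous : continuous chord.
Proof.
have ct : continuous (fun p : frame R r * I => set_val p.2 : R).
  move=> p; apply: (@continuous_comp _ _ _ snd (set_val : I -> R)); first exact: cvg_snd.
  exact: set_val_continuous.
have ct' : continuous (fun p : frame R r * I => 1 - set_val p.2 : R).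
  by move=> p; exact: (continuousB (@cst_continuous _ _ (1 : R) p) (ct p)).
have c1 : continuous (fun p : frame R r * I => set_val (fr1 p.1) : V).
  move=> p; apply: (@continuous_comp _ _ _ (@fr1 R r \o fst) (set_val : S -> V));
    last exact: sphere_val_continuous.
  by apply: continuous_comp; [exact: cvg_fst|exact: fr1_continuous].
have c2 : continuous (fun p : frame R r * I => set_val (fr2 p.1) : V).
  move=> p; apply: (@continuous_comp _ _ _ (@fr2 R r \o fst) (set_val : S -> V));
    last exact: sphere_val_continuous.
  by apply: continuous_comp; [exact: cvg_fst|exact: fr2_continuous].
have cv : continuous chord_vec.
  move=> p; exact: (continuousD (continuousZ (ct' p) (c1 p)) (continuousZ (ct p) (c2 p))).
move=> p; apply: (@continuous_comp _ _ _ (@normalize R r \o chord_vec) (@line R r));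
  last exact: line_continuous.
by apply: continuous_normalize; [exact: chord_vec_neq0|exact: cv].
Qed.

Definition chord_fun (a : frame R r) (t : I) : P := chord (a, t).

Lemma chord_fun_continuous a : continuous (chord_fun a).
Proof. exact: (continuous_curry chord_continuous).2. Qed.

HB.instance Definition _ a :=
  isContinuous.Build I P (chord_fun a) (@chord_fun_continuous a).

Definition chord_path (a : frame R r) : path_space R P := chord_fun a.

Lemma normalize_sphere (u : S) : normalize (set_val u) = u.
Proof.
apply: sphere_eq; rewrite normalizeE ?dot_sphereP ?sqrtr1 ?invr1 ?scale1r//.
apply/eqP => u0; have := dot_sphereP u; rewrite u0 /dot big1.
  by move/esym/eqP; rewrite oner_eq0.
by move=> i _; rewrite mxE mul0r.
Qed.

Lemma chord_fun0 a : chord_fun a (unit0 R) = line (fr1 a).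
Proof.
rewrite /chord_fun /chord /chord_vec /=.
have -> : set_val (unit0 R) = 0 :> R by [].
by rewrite subr0 scale1r scale0r addr0 normalize_sphere.
Qed.

Lemma chord_fun1 a : chord_fun a (unit1 R) = line (fr2 a).
Proof.
rewrite /chord_fun /chord /chord_vec /=.
have -> : set_val (unit1 R) = 1 :> R by [].
by rewrite subrr scale1r scale0r add0r normalize_sphere.
Qed.

Lemma chord1_subproof a :
  chord_path a \in [set g : path_space R P | g (unit0 R) <> g (unit1 R)].
Proof. by apply/mem_set; rewrite /= chord_fun0 chord_fun1; exact: frameP. Qed.

Definition chord1 (a : frame R r) : path_space1 R P := SigSub (chord1_subproof a).

Lemma ev1_chord1 a : ev1 (chord1 a) = conf a.
Proof. by apply: val_inj; rewrite /= /ev set_valE /= chord_fun0 chord_fun1. Qed.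

(** Currying: joint continuity in frame and time gives continuity into the compact-open topology. *)
Lemma chord1_continuous : continuous chord1.
Proof.
apply: set_type_continuous.
apply: (@continuous_comp_initial (path_space R P) _ _ (@path_val R P)).
exact: (continuous_curry chord_continuous).1.
Qed.

Lemma chord1_flip a : chord1 (flip a) = path_reversal R P (chord1 a).
Proof.
apply: val_inj; apply/continuousEP => t /=.
rewrite /chord_fun /chord /chord_vec /= flip1 flip2.
have -> : set_val (unit_onem t) = 1 - set_val t :> R by [].
by congr (line (normalize _)); rewrite addrC; congr (_ *: _ + _); rewrite opprB addrC subrK.
Qed.

(** This word negates both vectors and is the central element of the dihedral group; the chord
    vector changes sign and its line stays the same. *)
Lemma chord1_opp a : chord1 (flip (negr (flip (negr a)))) = chord1 a.
Proof.
apply: val_inj; apply/continuousEP => t /=.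
rewrite /chord_fun /chord.
have -> : chord_vec (flip (negr (flip (negr a))), t) = - chord_vec (a, t).
  rewrite /chord_vec /= !(flip1, flip2, negr1, negr2) !antipodeE.
  by rewrite !scalerN -opprD.
by rewrite normalizeN ?chord_vec_neq0// lineN.
Qed.

End chords.

(** * From functions on frames to local sections *)

Section cover_of_family.
Variables (R : realType) (r : nat).
Local Notation P := (projective_space R r).

(** Over an unordered pair of lines the section picks the chord of a frame on which [h] is positive.
    Such a frame is unique up to [flip] and negation of both vectors, which preserve the unoriented
    chord. *)
Lemma section_of_function (h : frame R r -> R) :
  continuous h -> (forall a, h (flip a) = h a) -> (forall a, h (negr a) = - h a) ->
  has_section_over (@ev2 R P) (@conf_orbit R r @` [set a | h a != 0]).
Proof.
move=> ch hf hr; set U := _ @` _.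
pose op := orbit_proj (path_reversal R P).
pose psi a := if 0 < h a then op (chord1 a) else op (chord1 (negr a)).
have op_flip a : op (chord1 (flip a)) = op (chord1 a).
  by rewrite chord1_flip; apply/orbit_projP; right.
have op_nflip a : op (chord1 (negr (flip a))) = op (chord1 (negr a)).
  (* [flip (negr (flip a))] is [negr a] with both vectors negated, so the two have the same
     chord. *)
  by rewrite -op_flip -(chord1_opp (negr a)) negrK.
have psi_negr a : h a != 0 -> psi (negr a) = psi a.
  move=> ha; rewrite /psi hr oppr_gt0 negrK.
  by have [h0|h0|e] := ltgtP 0 (h a) => //; rewrite -e eqxx in ha.
have psi_flip a : psi (flip a) = psi a.
  by rewrite /psi hf op_flip op_nflip.
have psi_fiber a b : h a != 0 -> conf_orbit a = conf_orbit b -> psi b = psi a.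
  move=> ha ab.
  (* Nonvanishing is carried along because the invariance of [psi] under [negr] is available only
     where [h] is nonzero. *)
  suff [] : h b != 0 /\ psi b = psi a by [].
  apply: (@conf_orbit_fiber R r (fun c => h c != 0 /\ psi c = psi a) a b) => //.
    by move=> c [hc e]; rewrite hr oppr_eq0 psi_negr.
  by move=> c [hc e]; rewrite hf psi_flip.
pose rep (b : orbit_space (conf2_swap P)) := sval (cid (conf_orbit_surj b)).
have repK b : conf_orbit (rep b) = b by exact: (svalP (cid (conf_orbit_surj b))).
pose s b := psi (rep b).
have sE a : h a != 0 -> s (conf_orbit a) = psi a.
  by move=> ha; apply: psi_fiber; rewrite ?repK.
exists (fun b : U => s (set_val b)); split=> [b|b].
  apply: (@continuous_comp _ _ _ (set_val : U -> _) s); first exact: set_val_continuous.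
  (* Up to [negr] the representative has [h] positive; near it the section is just the class of the
     chord. *)
  have [a [ha <-]] : exists a, 0 < h a /\ conf_orbit a = set_val b.
    have [a /= ha <-] : U (set_val b) by exact: set_valP.
    have [h0|h0|e] := ltgtP 0 (h a); first by exists a.
      by exists (negr a); rewrite conf_orbit_negr hr oppr_gt0.
    by rewrite -e eqxx in ha.
  apply: (open_map_continuous_at (@conf_orbit_open R r)).
  have near_s : \forall c \near a, s (conf_orbit c) = op (chord1 c).
    have : \forall c \near a, 0 < h c by exact: (ch a [set k | 0 < k] (lt_nbhsr ha)).
    by apply: filterS => c hc; rewrite sE ?gt_eqF// /psi hc.
  have c : {for a, continuous (op \o @chord1 R r)}.
    by apply: continuous_comp; [exact: chord1_continuous|exact: orbit_proj_continuous].
  move=> W; rewrite /= (nbhs_singleton near_s) => aW.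
  have : \forall d \near a, W (op (chord1 d)) by exact: (c W aW).
  by apply: filterS2 near_s => d /= ->.
have [a /= ha <-] : U (set_val b) by exact: set_valP.
rewrite sE// /psi; case: ifP => _; rewrite ev2E ev1_chord1 //.
by rewrite conf_negr.
Qed.

End cover_of_family.

(** * An invariant metric on frames and the distance to a complement *)

Section distance.
Variables (R : realType) (r : nat).
Local Notation S := (sphere R r).
Local Notation V := 'rV[R]_r.+1.

(** A metric for the topology of frames that makes [flip] and [negr] isometries, so that the
    distance to an invariant set is invariant. *)
Definition fdist (a b : frame R r) : R :=
  `|set_val (fr1 a) - set_val (fr1 b) : V| + `|set_val (fr2 a) - set_val (fr2 b) : V|.

Lemma fdist_ge0 a b : 0 <= fdist a b.
Proof. by rewrite addr_ge0. Qed.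

Lemma fdistxx a : fdist a a = 0.
Proof. by rewrite /fdist !subrr normr0 addr0. Qed.

Lemma fdistC a b : fdist a b = fdist b a.
Proof. by rewrite /fdist distrC; congr (_ + _); rewrite distrC. Qed.

Lemma fdist_triangle b a c : fdist a c <= fdist a b + fdist b c.
Proof. by rewrite /fdist addrACA lerD// ler_distD. Qed.

Lemma fdist_flip a b : fdist (flip a) (flip b) = fdist a b.
Proof. by rewrite /fdist !flip1 !flip2 addrC. Qed.

Lemma fdist_negr a b : fdist (negr a) (negr b) = fdist a b.
Proof.
by rewrite /fdist !negr1 !negr2 !antipodeE; congr (_ + _); rewrite -opprD normrN.
Qed.

Lemma sphere_nbhs (u : S) (W : set S) : nbhs u W ->
  exists2 e : R, 0 < e & forall v : S, `|set_val u - set_val v : V| < e -> W v.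
Proof.
move=> /set_type_nbhs[W' /nbhs_normP[e e0 eW'] W'W].
by exists e => // v uv; apply: W'W; exact: eW'.
Qed.

Lemma fdist_nbhs (a : frame R r) (W : set (frame R r)) : nbhs a W ->
  exists2 e : R, 0 < e & forall b, fdist a b < e -> W b.
Proof.
move=> /set_type_nbhs[W' [[A B] /= [/sphere_nbhs[e1 e10 A1] /sphere_nbhs[e2 e20 B2]] ABW'] W'W].
exists (Num.min e1 e2); first by rewrite lt_min e10.
move=> b; rewrite lt_min => /andP[b1 b2]; apply: W'W; apply: ABW'; split => /=.
  by apply: A1; apply: le_lt_trans b1; rewrite lerDl.
by apply: B2; apply: le_lt_trans b2; rewrite lerDr.
Qed.

Lemma fdist_near (a : frame R r) (e : R) : 0 < e -> \forall b \near a, fdist a b < e.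
Proof.
move=> e0.
have c1 : {for a, continuous (fun b : frame R r => set_val (fr1 b) : V)}.
  apply: (@continuous_comp _ _ _ (@fr1 R r) (set_val : S -> V)).
    exact: fr1_continuous.
  exact: sphere_val_continuous.
have c2 : {for a, continuous (fun b : frame R r => set_val (fr2 b) : V)}.
  apply: (@continuous_comp _ _ _ (@fr2 R r) (set_val : S -> V)).
    exact: fr2_continuous.
  exact: sphere_val_continuous.
have e2 : 0 < e / 2 by rewrite divr_gt0.
have n1 : \forall b \near a, `|set_val (fr1 a) - set_val (fr1 b) : V| < e / 2.
  by move/cvgrPdist_lt: c1 => /(_ _ e2).
have n2 : \forall b \near a, `|set_val (fr2 a) - set_val (fr2 b) : V| < e / 2.
  by move/cvgrPdist_lt: c2 => /(_ _ e2).
by apply: filterS2 n1 n2 => b b1 b2; rewrite /fdist [e]splitr ltrD.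
Qed.

(* The element 1 makes the infimum meaningful when O is everything. *)
Definition rho (O : set (frame R r)) (a : frame R r) : R :=
  inf ([set 1] `|` [set fdist a c | c in ~` O]).

Lemma rho_set_lb O a : lbound ([set 1] `|` [set fdist a c | c in ~` O]) 0.
Proof. by move=> _ [->|[c _ <-]]; [exact: ler01|exact: fdist_ge0]. Qed.

Lemma rho_set_neq0 O a : ([set 1] `|` [set fdist a c | c in ~` O]) !=set0.
Proof. by exists 1; left. Qed.

Lemma rho_ge0 O a : 0 <= rho O a.
Proof. by apply: lb_le_inf; [exact: rho_set_neq0|exact: rho_set_lb]. Qed.

Lemma rho_le O a k : ([set 1] `|` [set fdist a c | c in ~` O]) k -> rho O a <= k.
Proof. by apply: ge_inf; exists 0; exact: rho_set_lb. Qed.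

Lemma rho_out O a : ~ O a -> rho O a = 0.
Proof.
move=> Oa; apply/eqP; rewrite eq_le rho_ge0 andbT.
by apply: rho_le; right; exists a => //; exact: fdistxx.
Qed.

Lemma rho_gt0 O a : open O -> O a -> 0 < rho O a.
Proof.
rewrite openE => oO /oO /fdist_nbhs[e e0 eO].
apply: (@lt_le_trans _ _ (Num.min 1 e)); first by rewrite lt_min ltr01.
apply: lb_le_inf; first exact: rho_set_neq0.
move=> _ [->|[c Oc <-]]; rewrite ge_min ?lexx//.
by apply/orP; right; rewrite leNgt; apply/negP => /eO.
Qed.

Lemma rho_lipschitz O a b : rho O a <= rho O b + fdist a b.
Proof.
rewrite -lerBlDr; apply: lb_le_inf; first exact: rho_set_neq0.
move=> _ [->|[c Oc <-]]; rewrite lerBlDr.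
  by rewrite ler_wpDr ?fdist_ge0//; apply: rho_le; left.
rewrite addrC; apply: le_trans (fdist_triangle b a c).
by apply: rho_le; right; exists c.
Qed.

Lemma rho_near O (a : frame R r) (e : R) : 0 < e -> \forall b \near a, `|rho O a - rho O b| < e.
Proof.
move=> e0; have := fdist_near a e0; apply: filterS => b ab.
apply: le_lt_trans ab; rewrite ler_distlC.
have := rho_lipschitz O a b; have := rho_lipschitz O b a.
by rewrite (fdistC b a) lerBlDr => -> ->.
Qed.

(** An involution preserving [O] also preserves its complement, so an isometric one only permutes
    the distances. *)
Lemma rho_isometry O (g : frame R r -> frame R r) a :
  involutive g -> (forall a b, fdist (g a) (g b) = fdist a b) ->
  (forall c, O c -> O (g c)) -> rho O (g a) = rho O a.
Proof.
move=> gK gd gO; rewrite /rho; congr (inf (_ `|` _)).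
have gO' c : ~ O c -> ~ O (g c) by move=> Oc /gO; rewrite gK.
apply/seteqP; split=> _ [c /gO' Oc <-]; exists (g c) => //.
by rewrite -(gd a) gK.
Qed.

End distance.

Lemma continuous_at_dist (R : realType) (T : topologicalType) (f : T -> R) (t : T) :
  (forall e, 0 < e -> \forall s \near t, `|f t - f s| < e) ->
  {for t, continuous f}.
Proof. by move=> ft; apply/cvgrPdist_lt. Qed.

(** * From local sections to functions on frames *)

Section family_of_cover.
Variables (R : realType) (r : nat).
Local Notation S := (sphere R r).
Local Notation P := (projective_space R r).
Local Notation I := (unit_interval R).
Local Notation B := (orbit_space (conf2_swap P)).

Lemma negr_continuous : continuous (@negr R r).
Proof.
apply: frame_continuous; first exact: fr1_continuous.
move=> a; apply: (@continuous_comp _ _ _ (@fr2 R r) (antipode R r)).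
  exact: fr2_continuous.
exact: Defs.inv_continuous.
Qed.

(** Evaluation is continuous for the compact-open topology because the interval is locally compact
    and Hausdorff. *)
Lemma path_eval_continuous :
  continuous (fun p : path_space1 R P * I => set_val p.1 p.2 : P).
Proof.
have -> : (fun p : path_space1 R P * I => set_val p.1 p.2 : P) =
   uncurry ((@path_val R P \o set_val) : path_space1 R P -> I -> P).
  by apply/funext => -[].
apply: continuous_uncurry.
- exact: unit_interval_locally_compact.
- exact: unit_interval_hausdorff.
- have c : continuous (@path_val R P \o (set_val : path_space1 R P -> path_space R P)).
    move=> g; apply: continuous_comp; first exact: set_val_continuous.
    exact: (@initial_continuous _ _ (@path_val R P)).
  exact: c.
- by move=> g; exact: cts_fun.
Qed.

(** [h] is the sign that the lifted path attaches to a frame, times the truncated distance to the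
    complement of the domain, so that it extends by zero. *)
Lemma function_of_section (U : set B) :
  open U -> has_section_over (@ev2 R P) U ->
  exists h : frame R r -> R,
    [/\ continuous h, forall a, h (flip a) = h a, forall a, h (negr a) = - h a
      & forall a, U (conf_orbit a) -> h a != 0].
Proof.
move=> oU [s [cs sP]].
pose op := orbit_proj (path_reversal R P).
(* Of the two orientations of the path chosen by [s], this singles out the one running from the
   first line of [a] to the second. *)
pose over a (g : path_space1 R P) := ev1 g = conf a /\
  exists2 b : U, set_val b = conf_orbit a & op g = s b.
have over_flip a g : over a g -> over (flip a) (path_reversal R P g).
  move=> [ga [b ba gb]]; split; first by rewrite ev1_equivariant ga conf_flip.
  exists b; first by rewrite conf_orbit_flip.
  by rewrite -gb; apply/orbit_projP; right.
have over_negr a g : over a g -> over (negr a) g.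
  move=> [ga [b ba gb]]; split; first by rewrite conf_negr.
  by exists b; rewrite // conf_orbit_negr.
have over_exists a : U (conf_orbit a) -> exists g, over a g.
  move=> Ua; pose b : U := SigSub (mem_set Ua).
  have [g gb] := orbit_proj_surj (s b).
  have : orbit_proj (conf2_swap P) (ev1 g) = conf_orbit a.
    by rewrite -ev2E gb sP.
  move=> /orbit_projP[ga|ga]; first by exists g; split => //; exists b.
  exists (path_reversal R P g); split.
    by rewrite ev1_equivariant ga; exact: inv_involutive.
  by exists b => //; rewrite -gb; apply/orbit_projP; right.
have over_unique a g g' : over a g -> over a g' -> g = g'.
  move=> [ga [b ba gb]] [g'a [b' b'a g'b']].
  have e : b = b' by apply: val_inj; rewrite -!set_valE ba b'a.
  have /orbit_projP[//|gg'] : op g = op g' by rewrite gb g'b' e.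
  by have := ga; rewrite gg' ev1_equivariant g'a => /(@inv_free _ (conf2_swap P)).
have over_ends a g : over a g ->
    line (fr1 a) = set_val g (unit0 R) /\ line (fr2 a) = set_val g (unit1 R).
  by move=> [/(congr1 set_val) /= [-> ->]].
(* Positive sign: the lift starting at the first vector ends at the second one and not at its
   antipode. *)
pose pos a := exists2 g, over a g & joined (set_val g) (fr1 a) (fr2 a).
have pos_flip a : pos a -> pos (flip a).
  move=> [g ga gj]; exists (path_reversal R P g); first exact: over_flip.
  exact: joined_rev.
have pos_total a : U (conf_orbit a) -> pos a \/ pos (negr a).
  move=> /over_exists[g ga]; have [u0 v1] := over_ends _ _ ga.
  have [|j|j] := @joined_total R r (set_val g) (fr1 a) (fr2 a) _ u0 v1.
  - exact: cts_fun.
  - by left; exists g.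
  - by right; exists g => //; exact: over_negr.
have pos_negr a : pos a -> ~ pos (negr a).
  move=> [g ga gj] [g' g'a g'j].
  have e : g = g' by apply: (over_unique (negr a)) => //; exact: over_negr.
  by move: g'j; rewrite -e; exact: joined_antipode.
have pos_near a : pos a -> \forall b \near a, pos b.
  move=> [g ga gj]; have [b ba gb] := ga.2; have [u0 v1] := over_ends _ _ ga.
  have n1 := near_nonorthogonal g path_eval_continuous.
  (* This rules out reversed paths: a path near [g] does not start at the second line of a frame
     near [a]. *)
  have n2 : nbhs (g, a) [set p : path_space1 R P * frame R r |
      cos2 (set_val p.1 (unit0 R)) (line (fr2 p.2)) < 1].
    have c : {for (g, a), continuous (fun p : path_space1 R P * frame R r =>
        cos2 (set_val p.1 (unit0 R)) (line (fr2 p.2)))}.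
      have c1 : {for (g, a), continuous (fun p : path_space1 R P * frame R r =>
          set_val p.1 (unit0 R) : P)}.
        apply: (@continuous_comp _ _ _ (fun p : path_space1 R P * frame R r =>
          (p.1, unit0 R)) (fun q : path_space1 R P * I => set_val q.1 q.2 : P)).
          by apply: continuous_pair; [exact: cvg_fst|exact: cst_continuous].
        exact: path_eval_continuous.
      have c2 : {for (g, a), continuous (fun p : path_space1 R P * frame R r =>
          line (fr2 p.2))}.
        apply: (@continuous_comp _ _ _ (@fr2 R r \o snd) (@line R r)).
          by apply: continuous_comp; [exact: cvg_snd|exact: fr2_continuous].
        exact: line_continuous.
      apply: (@continuous_comp _ _ _ (fun p : path_space1 R P * frame R r =>
        (set_val p.1 (unit0 R) : P, line (fr2 p.2))) (fun q => cos2 q.1 q.2)).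
        exact: (continuous_pair c1 c2).
      exact: cos2_continuous.
    have lt1 : cos2 (set_val g (unit0 R)) (line (fr2 a)) < 1.
      rewrite lt_neqAle cos2_le1 andbT; apply/eqP => /cos2_eq1.
      by rewrite -u0; exact: frameP.
    exact: (c [set k | k < 1] (lt_nbhsl lt1)).
  have [[N M] /= [gN aM] NM] := n2.
  pose N' := N `&` [set g' : path_space1 R P | forall t, 0 < cos2 (set_val g' t) (set_val g t)].
  (* As the orbit projection is open, the values of [s] near [b] have representatives in [N'], hence
     close to [g]. *)
  have nN : nbhs (s b) (op @` N').
    by rewrite -gb; apply: orbit_proj_open; exact: filterI.
  have /set_type_nbhs[W bW WN] := cs b _ nN.
  have aW : \forall c \near a, W (conf_orbit c).
    by apply: conf_orbit_continuous; rewrite -ba.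
  have aU : \forall c \near a, U (conf_orbit c).
    apply: conf_orbit_continuous; rewrite -ba.
    by move: oU; rewrite openE; apply; exact: set_valP.
  have dot_near (f : frame R r -> S) : continuous f ->
      \forall c \near a, 0 < dot (set_val (f c)) (set_val (f a)).
    move=> cf; have c : {for a, continuous (fun c => dot (set_val (f c)) (set_val (f a)))}.
      apply: dot_continuous; last exact: cst_continuous.
      apply: (@continuous_comp _ _ _ f (set_val : S -> 'rV[R]_r.+1)); first exact: cf.
      exact: sphere_val_continuous.
    have d1 : 0 < dot (set_val (f a)) (set_val (f a)) by rewrite dot_sphereP ltr01.
    exact: (c [set k | 0 < k] (lt_nbhsr d1)).
  have d1 := dot_near _ (@fr1_continuous R r).
  have d2 := dot_near _ (@fr2_continuous R r).
  near=> c.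
  have Wc : W (conf_orbit c) by near: c.
  have Mc : M c by near: c.
  have d1c : 0 < dot (set_val (fr1 c)) (set_val (fr1 a)) by near: c.
  have d2c : 0 < dot (set_val (fr2 c)) (set_val (fr2 a)) by near: c.
  have Uc : U (conf_orbit c) by near: c.
  pose b' : U := SigSub (mem_set Uc).
  have [g' [Ng' g'g] g'b'] : (op @` N') (s b').
    exact: WN.
  have g'c : over c g'.
    split; last by exists b'.
    have : orbit_proj (conf2_swap P) (ev1 g') = conf_orbit c by rewrite -ev2E -/op g'b' sP.
    (* With the wrong orientation [g'] would start at the second line of [c], against [n2]. *)
    move=> /orbit_projP[//|]; rewrite -conf_flip => /(congr1 set_val) /= [e _].
    have : cos2 (set_val g' (unit0 R)) (line (fr2 c)) < 1.
      exact: (NM (g', c)).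
    by have /cos2_eq1 -> := e; rewrite ltxx.
  exists g' => //; have [u0' v1'] := over_ends _ _ g'c.
  by apply: (joined_near _ gj g'g u0' v1' d1c d2c); exact: cts_fun.
pose O : set (frame R r) := [set a | U (conf_orbit a)].
have oO : open O by apply: open_comp => // a _; exact: conf_orbit_continuous.
(* Outside [O] no frame satisfies [pos], but there [rho] vanishes and the sign has no effect. *)
pose h a := if pselect (pos a) then rho O a else - rho O a.
have h_norm a : `|h a| = rho O a.
  rewrite /h; case: pselect => _ /=; last rewrite (normrN (rho O a)).
    by rewrite ger0_norm ?rho_ge0.
  by rewrite ger0_norm ?rho_ge0.
have rho_flip a : rho O (flip a) = rho O a.
  apply: rho_isometry; [exact: flipK|exact: fdist_flip|].
  by move=> c; rewrite /O /= conf_orbit_flip.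
have rho_negr a : rho O (negr a) = rho O a.
  apply: rho_isometry; [exact: negrK|exact: fdist_negr|].
  by move=> c; rewrite /O /= conf_orbit_negr.
exists h; split=> [a|a|a|a Ua].
- have [Oa|Oa] := pselect (O a); last first.
    apply: continuous_at_dist => e e0; have := rho_near O a e0.
    apply: filterS => b.
    have -> : h a = 0 by apply/normr0_eq0; rewrite h_norm rho_out.
    by rewrite rho_out// !sub0r (normrN (rho O b)) (normrN (h b)) h_norm ger0_norm ?rho_ge0.
  (* The sign is locally constant on [O]: failure of [pos a] means [pos (negr a)], an open condition
     as well. *)
  have near_pos : \forall b \near a, pos b <-> pos a.
    have [pa|pa] := pselect (pos a); first by have := pos_near _ pa; apply: filterS.
    have [//|pna] := pos_total _ Oa.
    have : \forall b \near a, pos (negr b).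
      by apply: negr_continuous; exact: pos_near.
    by apply: filterS => b pnb; split=> // /pos_negr.
  apply: continuous_at_dist => e e0.
  apply: filterS2 near_pos (rho_near O a e0) => b ab.
  rewrite /h; case: pselect => pa; case: pselect => pb //=.
  + by have := pb (ab.2 pa).
  + by have := pa (ab.1 pb).
  + by rewrite (opprK (rho O b)) (addrC (- rho O a)) distrC.
- rewrite /h rho_flip; case: pselect => pf; case: pselect => p //=.
    by case: p; rewrite -(flipK a); exact: pos_flip.
  by case: pf; exact: pos_flip.
- rewrite /h rho_negr; case: pselect => pn; case: pselect => p //=.
  + by have := pos_negr _ p pn.
  + by rewrite opprK.
  + have [Oa|Oa] := pselect (O a); last by rewrite rho_out// !oppr0.
    by have [] := pos_total _ Oa.
- by rewrite -normr_eq0 h_norm gt_eqF// rho_gt0.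
Unshelve. all: by end_near. Qed.

End family_of_cover.

(** * Comparison of the genus with the level *)

Section cover.
Variables (R : realType) (r : nat).
Local Notation P := (projective_space R r).

(** A section over each member of a cover yields a function that is nonzero there; conversely the
    nonvanishing loci of a family project to a cover. *)
Lemma cover_family n :
  (exists U : 'I_n -> set (orbit_space (conf2_swap P)),
    [/\ forall i, open (U i), \bigcup_i U i = setT
      & forall i, has_section_over (@ev2 R P) (U i)]) <->
  exists h : 'I_n -> frame R r -> R, frame_family h.
Proof.
split=> [[U [oU UT sU]]|[h [ch hf hr h0]]].
  have /choice[h hP] : forall i, exists h : frame R r -> R,
      [/\ continuous h, forall a, h (flip a) = h a, forall a, h (negr a) = - h a
        & forall a, U i (conf_orbit a) -> h a != 0].
    by move=> i; exact: function_of_section.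
  exists h; split=> [i|i a|i a|a]; try by case: (hP i).
  have [i _ Ui] : (\bigcup_i U i) (conf_orbit a) by rewrite UT.
  by exists i; case: (hP i) => _ _ _; apply.
exists (fun i => @conf_orbit R r @` [set a | h i a != 0]); split=> [i||i].
- apply: (open_map_open (@conf_orbit_open R r)).
  apply: (@open_comp _ _ (h i) [set k | k != 0]); first by move=> a _; exact: ch.
  exact: open_neq.
- apply/seteqP; split=> // b _; have [a <-] := conf_orbit_surj b.
  by have [i hi] := h0 a; exists i => //; exists a.
- exact: section_of_function.
Qed.

(** Two distinct basis vectors form a frame. Its existence excludes the empty family, so the common
    minimum is positive, as the level demands. *)
Lemma frame_inhabited : (1 <= r)%N -> inhabited (frame R r).
Proof.
move=> r1; pose e i : 'rV[R]_r.+1 := delta_mx ord0 i.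
have dotE i j : dot (e i) (e j) = (i == j)%:R.
  rewrite /dot (bigD1 i)//= !mxE !eqxx mul1r big1 ?addr0// => k ki.
  by rewrite !mxE (negPf ki) andbF mul0r.
have eS i : e i \in [set x : 'rV[R]_r.+1 | \sum_i x ord0 i ^+ 2 = 1].
  by apply/mem_set; have := dotE i i; rewrite eqxx.
pose s i : sphere R r := SigSub (eS i).
have s01 : line (s ord0) <> line (s ord_max).
  move=> /cos2_eq1; rewrite cos2E.
  have -> : dot (set_val (s ord0)) (set_val (s ord_max)) = 0.
    rewrite [LHS]dotE; suff -> : (ord0 == ord_max :> 'I_r.+1) = false by [].
    by apply/negbTE; rewrite -val_eqE /= eq_sym -lt0n.
  by move=> /eqP; rewrite expr0n eq_sym oner_eq0.
by constructor; exact: (mkframe s01).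
Qed.

End cover.

Theorem theorem1p4 (R : realType) (r : nat) (hr : (1 <= r)%N) :
  exists l : nat, is_level R (conf2_swap (projective_space R r)) l /\
    is_TCS R (projective_space R r) (l + 1)%N.
Proof.
(* Level and genus are both the least [n] satisfying this condition. *)
pose F n := exists h : 'I_n -> frame R r -> R, frame_family h.
have F_gt0 n : F n -> (0 < n)%N.
  move=> [h [_ _ _ h0]]; have [a] := frame_inhabited R hr.
  by have [i _] := h0 a; exact: leq_ltn_trans (ltn_ord i).
(* For positive [n], a point of [sphere R n.-1] has exactly [n] coordinates. *)
have levelE n : ((0 < n)%N /\ exists f : conf2 (projective_space R r) -> sphere R n.-1,
    continuous f /\ forall x, f (conf2_swap _ x) = antipode R n.-1 (f x)) <-> F n.
  split=> [[]|Fn]; first by case: n => // n _ /equivariant_odd_family/odd_family_frame.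
  split; first exact: F_gt0.
  case: n Fn (F_gt0 n Fn) => // n Fn _.
  exact/equivariant_odd_family/odd_family_frame.
(* The existence of some finite family guarantees that the minimum is attained. *)
have [n Fn] : exists n, `[< F n >].
  have [n kn] := odd_family_exists R r.
  by exists n; apply/asboolP/odd_family_frame.
have exF : exists n, `[< F n >] by exists n.
pose l := ex_minn exF.
have [/asboolP Fl lmin] : `[< F l >] /\ forall m, `[< F m >] -> (l <= m)%N.
  by rewrite /l; case: ex_minnP.
exists l; split.
  by split=> [|m /levelE Fm]; [exact/levelE|apply: lmin; exact/asboolP].
exists l => //; split=> [|m /cover_family Fm]; first exact/cover_family.
by apply: lmin; exact/asboolP.
Qed.
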